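(* The fused link group is invariant under fused isotopy. That is, if $\beta\in UVB_n$ and $\beta'\in UVB_m$ have fused isotopic closures $\hat\beta$ and $\hat\beta'$, then the groups $G(\beta)$ and $G(\beta')$ are isomorphic, where for $\beta\in UVB_n$ the group $G(\beta)$ (the fused link group $G(L)$ of the fused link $L$ represented by $\hat\beta$) is given by the presentation $$G(\beta)=\Big\langle x_1,\dots,x_n\ \Big|\ \phi(\beta)(x_i)=x_i\ \text{ for } i\in\{1,\dots,n\},\quad [x_i,[x_k,x_l]]=1\ \text{ for } i,k,l\in\{1,\dots,n\}\text{ not necessarily distinct}\Big\rangle .$$
   Context: Virtual link diagrams. A virtual link diagram is a closed oriented 1-manifold $D$ immersed in $\mathbb{R}^2$ such that all multiple points are transverse double points, each double point being marked as a positive crossing, a negative crossing (these two are called classical crossings and have the usual over/under information), or a virtual crossing. Diagrams are considered up to isotopy of $\mathbb{R}^2$. Fused isotopy. Fused isotopy is the equivalence relation on virtual link diagrams generated by the following local moves (with all orientations of strands): the classical Reidemeister moves of types I, II and III (involving only classical crossings); the virtual Reidemeister moves of types I, II and III (the same planar moves with all crossings virtual); the mixed Reidemeister move, a move of type III in which an arc having two consecutive virtual crossings is moved across a classical crossing; and the two forbidden moves, which are moves of type III with two classical crossings and one virtual crossing: an arc passing over (respectively, under) two other arcs at two consecutive classical crossings is moved across the virtual crossing of these two other arcs, remaining over (respectively, under) both of them. A fused link is an equivalence class of virtual link diagrams under fused isotopy. Every fused link is represented by the closure of an unrestricted virtual braid. Unrestricted virtual braids. The group of unrestricted virtual braids $UVB_n$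 is the group with generators $\sigma_1,\dots,\sigma_{n-1},\rho_1,\dots,\rho_{n-1}$ and defining relations: (R1) $\sigma_i\sigma_{i+1}\sigma_i=\sigma_{i+1}\sigma_i\sigma_{i+1}$ for $1\le i\le n-2$; (R2) $\sigma_i\sigma_j=\sigma_j\sigma_i$ for $|i-j|\ge 2$; (R3) $\rho_i\rho_{i+1}\rho_i=\rho_{i+1}\rho_i\rho_{i+1}$ for $1\le i\le n-2$; (R4) $\rho_i\rho_j=\rho_j\rho_i$ for $|i-j|\ge 2$; (R5) $\rho_i^2=1$ for $1\le i\le n-1$; (R6) $\sigma_i\rho_j=\rho_j\sigma_i$ for $|i-j|\ge 2$; (M) $\rho_i\rho_{i+1}\sigma_i=\sigma_{i+1}\rho_i\rho_{i+1}$ for $1\le i\le n-2$; (F1) $\rho_i\sigma_{i+1}\sigma_i=\sigma_{i+1}\sigma_i\rho_{i+1}$ for $1\le i\le n-2$; (F2) $\rho_{i+1}\sigma_i\sigma_{i+1}=\sigma_i\sigma_{i+1}\rho_i$ for $1\le i\le n-2$. Diagrams and closure. An element of $UVB_n$ is represented by a braid-like diagram on $n$ monotone strands, all oriented in the same direction: $\sigma_i$ (respectively $\sigma_i^{-1}$) is the diagram whose only crossing is a classical crossing between the strands in positions $i$ and $i+1$, positive (respectively negative), $\rho_i$ is the diagram whose only crossing is a virtual crossing between these strands, and the product is concatenation. The closure $\hat\beta$ of $\beta\in UVB_n$ is the virtual link diagram obtained from a diagram of $\beta$ by joining, for each position, the final endpoint to the initial endpoint by $n$ parallel arcs that are disjoint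 from each other and from the rest of the diagram; its fused isotopy class depends only on $\beta$. The representation $\phi$. $N_n=F_n/\gamma_3F_n$, where $F_n$ is the free group on $x_1,\dots,x_n$ and $\gamma_3F_n=[F_n,[F_n,F_n]]$. The homomorphism $\phi\colon UVB_n\to\operatorname{Aut}(N_n)$ sends $\sigma_i$ to the automorphism $x_i\mapsto x_ix_{i+1}x_i^{-1}$, $x_{i+1}\mapsto x_i$, $x_l\mapsto x_l$ ($l\neq i,i+1$), and $\rho_i$ to the automorphism $x_i\mapsto x_{i+1}$, $x_{i+1}\mapsto x_i$, $x_l\mapsto x_l$ ($l\neq i,i+1$); products of automorphisms are read from left to right (in $\alpha\beta$, $\alpha$ is applied first). In the presentation of $G(\beta)$, $\phi(\beta)(x_i)$ denotes any word in the $x_j$ representing this element of $N_n$. The commutator is $[x,y]=x^{-1}y^{-1}xy$. *)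

(* Defs.v *)
From HB Require Import structures.
From mathcomp Require Import all_boot all_order all_algebra.
From mathcomp Require Import zify.
From mathcomp Require Import all_classical all_reals all_analysis.
From Stdlib Require Import Relations.
Set Implicit Arguments.
Unset Strict Implicit.
Unset Printing Implicit Defensive.
Import Order.TTheory GRing.Theory Num.Theory.
Import numFieldNormedType.Exports.

Local Open Scope classical_set_scope.
Local Open Scope quotient_scope.
Local Open Scope group_scope.

Section FreeGroup.
Variable I : choiceType.

(* (i, true) stands for x_i and (i, false) for x_i^-1. *)
Definition word := seq (I * bool).

Inductive free_eq : word -> word -> Prop :=
| free_refl u : free_eq u u
| free_sym u v : free_eq u v -> free_eq v u
| free_trans u v w : free_eq u v -> free_eq v w -> free_eq u w
| free_cancel u v i b : free_eq (u ++ [:: (i, b); (i, ~~ b)] ++ v) (u ++ v).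

Definition free_rel : rel word := fun u v => `[< free_eq u v >].

Lemma free_rel_equiv : equiv_class_of free_rel.
Proof.
split.
- by move=> u; apply/asboolP; exact: free_refl.
- by move=> u v; apply/asboolP/asboolP; exact: free_sym.
- by move=> v u w /asboolP uv /asboolP vw; apply/asboolP; exact: free_trans vw.
Qed.

Canonical free_equiv := EquivRelPack free_rel_equiv.
Canonical free_encModRel := defaultEncModRel free_rel.

Definition free_group := {eq_quot free_rel}.
HB.instance Definition _ := Choice.on free_group.
HB.instance Definition _ := EqQuotient.on free_group.

Lemma free_piP u v : free_eq u v <-> \pi_free_group u = \pi_free_group v.
Proof.
split=> [uv|/eqmodP/asboolP//].
by apply/eqmodP/asboolP.
Qed.

Lemma free_eq_ctx a b u v : free_eq u v -> free_eq (a ++ u ++ b) (a ++ v ++ b).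
Proof.
elim=> {u v} [u|u v _ IH|u v w _ IH1 _ IH2|u v i c].
- exact: free_refl.
- exact: free_sym.
- exact: free_trans IH2.
- by have := free_cancel (a ++ u) (v ++ b) i c; rewrite -!catA.
Qed.

Lemma free_eq_cat u u' v v' :
  free_eq u u' -> free_eq v v' -> free_eq (u ++ v) (u' ++ v').
Proof.
move=> uu vv; apply: (@free_trans _ (u' ++ v)).
  by have := free_eq_ctx [::] v uu.
by have := free_eq_ctx u' [::] vv; rewrite !cats0.
Qed.

Definition word_inv (u : word) : word := rev [seq (l.1, ~~ l.2) | l <- u].

Lemma free_eq_invr u : free_eq (u ++ word_inv u) [::].
Proof.
elim: u => [|[i b] u IH]; first exact: free_refl.
have := free_eq_ctx [:: (i, b)] [:: (i, ~~ b)] IH.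
rewrite /word_inv map_cons rev_cons -cats1 /= catA => h.
exact: free_trans h (free_cancel [::] [::] i b).
Qed.

Lemma word_invK : involutive word_inv.
Proof.
move=> u; rewrite /word_inv map_rev revK -map_comp -[RHS]map_id.
by apply: eq_map => -[i b] /=; rewrite negbK.
Qed.

Lemma free_eq_invl u : free_eq (word_inv u ++ u) [::].
Proof. by have := free_eq_invr (word_inv u); rewrite word_invK. Qed.

Definition free_one : free_group := \pi_free_group [::].
Definition free_mul (x y : free_group) : free_group :=
  \pi_free_group (repr x ++ repr y).
Definition free_inv (x : free_group) : free_group :=
  \pi_free_group (word_inv (repr x)).

Lemma free_repr u : free_eq (repr (\pi_free_group u)) u.
Proof. by apply/free_piP; rewrite reprK. Qed.

Lemma free_mulE u v :
  free_mul (\pi_free_group u) (\pi_free_group v) = \pi_free_group (u ++ v).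
Proof.
by apply/free_piP; apply: free_eq_cat; exact: free_repr.
Qed.

Lemma free_mulA : associative free_mul.
Proof.
elim/quotW=> u; elim/quotW=> v; elim/quotW=> w.
by rewrite (free_mulE v) (free_mulE u v) !free_mulE catA.
Qed.

Lemma free_mul1 : left_id free_one free_mul.
Proof. by move=> x; rewrite -[x]reprK free_mulE. Qed.

Lemma free_1mul : right_id free_one free_mul.
Proof. by move=> x; rewrite -[x]reprK free_mulE cats0. Qed.

Lemma free_mulV : left_inverse free_one free_inv free_mul.
Proof.
move=> x; rewrite -{2}[x]reprK free_mulE; apply/free_piP/free_eq_invl.
Qed.

Lemma free_mulVr : right_inverse free_one free_inv free_mul.
Proof.
move=> x; rewrite -{1}[x]reprK free_mulE; apply/free_piP/free_eq_invr.
Qed.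

HB.instance Definition _ := isGroup.Build free_group
  free_mulA free_mul1 free_1mul free_mulV free_mulVr.

Definition free_gen (i : I) : free_group := \pi_free_group [:: (i, true)].

Lemma free_piM u v :
  \pi_free_group (u ++ v) = \pi_free_group u * \pi_free_group v.
Proof. by rewrite -free_mulE. Qed.

End FreeGroup.

Section FreeLift.
Variables (I : choiceType) (H : groupType) (f : I -> H).

Definition word_eval (w : word I) : H :=
  \prod_(l <- w) (if l.2 then f l.1 else (f l.1)^-1).

Lemma word_eval_cat u v : word_eval (u ++ v) = word_eval u * word_eval v.
Proof. exact: big_cat. Qed.

Lemma word_eval_eq u v : free_eq u v -> word_eval u = word_eval v.
Proof.
elim=> {u v} [//|u v _ -> //|u v w _ -> //|u v i b].
rewrite !word_eval_cat; congr (_ * _).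
rewrite [X in X * _](_ : _ = 1) ?mul1g //.
by rewrite /word_eval !big_cons big_nil mulg1; case: b => /=;
  rewrite ?mulgV ?mulVg.
Qed.

Definition free_lift (x : free_group I) : H := word_eval (repr x).

Lemma free_liftE w : free_lift (\pi w) = word_eval w.
Proof. exact/word_eval_eq/free_repr. Qed.

Lemma free_lift_morph : {morph free_lift : x y / x * y}.
Proof.
by move=> x y; rewrite -[x]reprK -[y]reprK -free_piM !free_liftE word_eval_cat.
Qed.

Lemma free_lift1 : free_lift 1 = 1.
Proof. by rewrite [LHS]free_liftE /word_eval big_nil. Qed.

HB.instance Definition _ :=
  isMultiplicative.Build _ _ free_lift free_lift_morph.
HB.instance Definition _ :=
  Multiplicative_isUMagmaMorphism.Build _ _ free_lift free_lift1.

Lemma free_lift_gen i : free_lift (free_gen i) = f i.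
Proof. by rewrite free_liftE /word_eval big_cons big_nil mulg1. Qed.
End FreeLift.

Lemma free_wordE (I : choiceType) (w : word I) :
  \pi w = word_eval (@free_gen I) w.
Proof.
elim: w => [|[i b] w IH]; first by rewrite /word_eval big_nil.
rewrite -cat1s free_piM IH word_eval_cat; congr (_ * _).
rewrite /word_eval big_cons big_nil mulg1; case: b => //=.
apply: (mulIg (free_gen i)); rewrite mulVg -free_piM.
by apply/free_piP; exact: (free_cancel [::] [::] i false).
Qed.

Section QuotientGroup.
Variables (G : groupType) (A : set G).

Inductive normal_closure : G -> Prop :=
| nclosure1 : normal_closure 1
| nclosureJ a g : A a -> normal_closure (a ^ g)
| nclosureM x y : normal_closure x -> normal_closure y -> normal_closure (x * y)
| nclosureV x : normal_closure x -> normal_closure x^-1.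

Lemma nclosure_sub a : A a -> normal_closure a.
Proof. by move=> /(nclosureJ 1); rewrite conjg1. Qed.

Lemma nclosure_conj x g : normal_closure x -> normal_closure (x ^ g).
Proof.
elim=> {x} [|a h Aa|x y _ IHx _ IHy|x _ IH].
- by rewrite conj1g; exact: nclosure1.
- by rewrite -conjgM; exact: nclosureJ.
- by rewrite conjMg; exact: nclosureM.
- by rewrite conjVg; exact: nclosureV.
Qed.

Definition quo_rel : rel G := fun x y => `[< normal_closure (x^-1 * y) >].

Lemma quo_rel_equiv : equiv_class_of quo_rel.
Proof.
split.
- by move=> x; apply/asboolP; rewrite mulVg; exact: nclosure1.
- by move=> x y; apply/asboolP/asboolP => /nclosureV; rewrite invgM invgK.
- move=> y x z /asboolP xy /asboolP yz; apply/asboolP.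
  by have := nclosureM xy yz; rewrite mulgA mulgK.
Qed.

Canonical quo_equiv := EquivRelPack quo_rel_equiv.
Canonical quo_encModRel := defaultEncModRel quo_rel.

Definition quo_group := {eq_quot quo_rel}.
HB.instance Definition _ := Choice.on quo_group.
HB.instance Definition _ := EqQuotient.on quo_group.

Lemma quo_piP x y :
  normal_closure (x^-1 * y) <-> \pi_quo_group x = \pi_quo_group y.
Proof. by split=> [xy|/eqmodP/asboolP//]; apply/eqmodP/asboolP. Qed.

Definition quo_one : quo_group := \pi_quo_group 1.
Definition quo_mul (x y : quo_group) : quo_group :=
  \pi_quo_group (repr x * repr y).
Definition quo_inv (x : quo_group) : quo_group := \pi_quo_group (repr x)^-1.

Lemma quo_repr x : normal_closure (x^-1 * repr (\pi_quo_group x)).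
Proof. by apply/quo_piP; rewrite reprK. Qed.

Lemma quo_mulE x y :
  quo_mul (\pi_quo_group x) (\pi_quo_group y) = \pi_quo_group (x * y).
Proof.
apply/esym/quo_piP.
set x' := repr _; set y' := repr _.
rewrite (_ : _ * _ = (x^-1 * x') ^ y * (y^-1 * y')).
  by apply: nclosureM; [apply: nclosure_conj|]; exact: quo_repr.
by rewrite conjgE invgM !mulgA mulgK.
Qed.

Lemma quo_mulA : associative quo_mul.
Proof.
elim/quotW=> x; elim/quotW=> y; elim/quotW=> z.
by rewrite (quo_mulE y) (quo_mulE x y) !quo_mulE mulgA.
Qed.

Lemma quo_mul1 : left_id quo_one quo_mul.
Proof. by move=> x; rewrite -[x]reprK quo_mulE mul1g. Qed.

Lemma quo_1mul : right_id quo_one quo_mul.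
Proof. by move=> x; rewrite -[x]reprK quo_mulE mulg1. Qed.

Lemma quo_mulV : left_inverse quo_one quo_inv quo_mul.
Proof. by move=> x; rewrite -{2}[x]reprK quo_mulE mulVg. Qed.

Lemma quo_mulVr : right_inverse quo_one quo_inv quo_mul.
Proof. by move=> x; rewrite -{1}[x]reprK quo_mulE mulgV. Qed.

HB.instance Definition _ := isGroup.Build quo_group
  quo_mulA quo_mul1 quo_1mul quo_mulV quo_mulVr.

Definition quo_pi (x : G) : quo_group := \pi_quo_group x.

Lemma quo_piM : {morph quo_pi : x y / x * y}.
Proof. by move=> x y; exact: esym (quo_mulE x y). Qed.

HB.instance Definition _ := isMultiplicative.Build _ _ quo_pi quo_piM.
HB.instance Definition _ :=
  Multiplicative_isUMagmaMorphism.Build _ _ quo_pi (erefl (1 : quo_group)).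

Lemma quo_pi_surj (x : quo_group) : exists y, quo_pi y = x.
Proof. by exists (repr x); rewrite /quo_pi reprK. Qed.

Lemma quo_pi_eq1 x : quo_pi x = 1 <-> normal_closure x.
Proof.
split=> [/esym/quo_piP|xA]; first by rewrite invg1 mul1g.
by apply/esym/quo_piP; rewrite invg1 mul1g.
Qed.

End QuotientGroup.

Section QuotientLift.
Variables (G H : groupType) (A : set G).
Variables (f : UMagmaMorphism.type G H) (fA : forall a, A a -> f a = 1).

Definition quo_lift (x : quo_group A) : H := f (repr x).

Lemma nclosure_lift x : normal_closure A x -> f x = 1.
Proof.
elim=> {x} [|a g /fA fa|x y _ fx _ fy|x _ fx].
- exact: gmulf1.
- by rewrite gmulfJ fa conj1g.
- by rewrite gmulfM fx fy mulg1.
- by rewrite gmulfV fx invg1.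
Qed.

Lemma quo_liftE x : quo_lift (quo_pi A x) = f x.
Proof.
have /nclosure_lift := quo_repr A x.
by rewrite gmulfM gmulfV => /mulg1_eq; rewrite invgK => ->.
Qed.

Lemma quo_lift_morph : {morph quo_lift : x y / x * y}.
Proof.
move=> x y; have [u <-] := quo_pi_surj x; have [v <-] := quo_pi_surj y.
by rewrite -quo_piM !quo_liftE gmulfM.
Qed.

Lemma quo_lift1 : quo_lift 1 = 1.
Proof. by rewrite [LHS]quo_liftE gmulf1. Qed.

HB.instance Definition _ := isMultiplicative.Build _ _ quo_lift quo_lift_morph.
HB.instance Definition _ :=
  Multiplicative_isUMagmaMorphism.Build _ _ quo_lift quo_lift1.
End QuotientLift.

Definition relators (I : choiceType)
    (E : free_group I -> free_group I -> Prop) : set (free_group I) :=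
  [set g | exists l r, E l r /\ g = l * r^-1].

Definition presented (I : choiceType)
    (E : free_group I -> free_group I -> Prop) : groupType :=
  quo_group (relators E).

Section AutGroup.
Variable G : groupType.

Definition is_aut : pred (G -> G) :=
  fun f => `[< {morph f : x y / x * y} /\ bijective f >].

Record aut := Aut { aut_fun :> G -> G; aut_proof : is_aut aut_fun }.
HB.instance Definition _ := [isSub for aut_fun].
HB.instance Definition _ := [Choice of aut by <:].

Lemma autP (a b : aut) : a =1 b -> a = b.
Proof. by move=> ab; apply/val_inj/funext. Qed.

Lemma autM (a : aut) : {morph a : x y / x * y}.
Proof. by have /asboolP[] := aut_proof a. Qed.

Lemma aut_bij (a : aut) : bijective a.
Proof. by have /asboolP[] := aut_proof a. Qed.

Lemma aut1 (a : aut) : a 1 = 1.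
Proof. by apply: (mulgI (a 1)); rewrite -autM !mulg1. Qed.

HB.instance Definition _ (a : aut) := isMultiplicative.Build G G a (autM a).
HB.instance Definition _ (a : aut) :=
  Multiplicative_isUMagmaMorphism.Build G G a (aut1 a).

Lemma aut_one_proof : is_aut id.
Proof. by apply/asboolP; split=> //; exists id. Qed.
Definition aut_one := Aut aut_one_proof.

(* Products are read from left to right: a is applied first. *)
Lemma aut_mul_proof (a b : aut) : is_aut (b \o a).
Proof.
apply/asboolP; split=> [x y|] /=; first by rewrite !autM.
exact: bij_comp (aut_bij b) (aut_bij a).
Qed.
Definition aut_mul a b := Aut (aut_mul_proof a b).

Lemma aut_inv_subproof (a : aut) : exists b : aut, cancel a b /\ cancel b a.
Proof.
have [g ag ga] := aut_bij a.
have gP : is_aut g.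
  by apply/asboolP; split; [exact: can2_gmulfM ag ga|exists a].
by exists (Aut gP).
Qed.
Definition aut_inv (a : aut) : aut := sval (cid (aut_inv_subproof a)).

Lemma aut_invK (a : aut) : cancel a (aut_inv a).
Proof. by rewrite /aut_inv; case: cid => b []. Qed.
Lemma aut_invVK (a : aut) : cancel (aut_inv a) a.
Proof. by rewrite /aut_inv; case: cid => b []. Qed.

Lemma aut_mulA : associative aut_mul. Proof. by move=> a b c; exact: autP. Qed.
Lemma aut_mul1 : left_id aut_one aut_mul. Proof. by move=> a; exact: autP. Qed.
Lemma aut_1mul : right_id aut_one aut_mul. Proof. by move=> a; exact: autP. Qed.
Lemma aut_mulV : left_inverse aut_one aut_inv aut_mul.
Proof. by move=> a; apply: autP => x /=; exact: aut_invVK. Qed.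
Lemma aut_mulVr : right_inverse aut_one aut_inv aut_mul.
Proof. by move=> a; apply: autP => x /=; exact: aut_invK. Qed.

HB.instance Definition _ := isGroup.Build aut
  aut_mulA aut_mul1 aut_1mul aut_mulV aut_mulVr.

Lemma autV (a : aut) : {morph a : x / x^-1}.
Proof. exact: gmulfV. Qed.

Lemma aut_mulE (a b : aut) x : (a * b) x = b (a x). Proof. by []. Qed.
End AutGroup.

Section Commutators.
Variable G : groupType.

Inductive subgroup_gen (A : set G) : set G :=
| sgen1 : subgroup_gen A 1
| sgen_in a : A a -> subgroup_gen A a
| sgenM x y : subgroup_gen A x -> subgroup_gen A y -> subgroup_gen A (x * y)
| sgenV x : subgroup_gen A x -> subgroup_gen A x^-1.

Definition commutator_subgroup (A B : set G) : set G :=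
  subgroup_gen [set g | exists a b, [/\ A a, B b & g = [~ a, b]]].

Definition gamma3 : set G :=
  commutator_subgroup setT (commutator_subgroup setT setT).
End Commutators.

Lemma commutator_image (G H : groupType) (f : UMagmaMorphism.type G H)
    (A B : set G) (A' B' : set H) x :
    (forall a, A a -> A' (f a)) -> (forall b, B b -> B' (f b)) ->
  commutator_subgroup A B x -> commutator_subgroup A' B' (f x).
Proof.
move=> AA BB; elim=> {x} [|_ [a [b [Aa Bb ->]]]|x y _ fx _ fy|x _ fx].
- by rewrite gmulf1; exact: sgen1.
- apply: sgen_in; exists (f a), (f b).
  by split; [exact: AA|exact: BB|exact: gmulfR].
- by rewrite gmulfM; exact: sgenM.
- by rewrite gmulfV; exact: sgenV.
Qed.

Lemma gamma3_image (G H : groupType) (f : UMagmaMorphism.type G H) x :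
  gamma3 x -> gamma3 (f x).
Proof.
apply: commutator_image => // y; exact: commutator_image.
Qed.

Section Nilpotent.
Variable n : nat.

Definition N : groupType := quo_group (@gamma3 (free_group 'I_n)).

Definition N_pi : free_group 'I_n -> N := @quo_pi _ _.
HB.instance Definition _ := UMagmaMorphism.on N_pi.

Definition N_gen (i : 'I_n) : N := N_pi (free_gen i).

Lemma N_class2 (x y z : N) : [~ x, [~ y, z]] = 1.
Proof.
have [u <-] := quo_pi_surj x; have [v <-] := quo_pi_surj y.
have [w <-] := quo_pi_surj z.
transitivity (N_pi [~ u, [~ v, w]]); first by rewrite !gmulfR.
apply/quo_pi_eq1/nclosure_sub.
apply: sgen_in; exists u, [~ v, w]; split=> //.
by apply: sgen_in; exists v, w.
Qed.

Lemma N_gamma3 (x : N) : gamma3 x -> x = 1.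
Proof.
have C (y : N) : commutator_subgroup setT setT y -> forall z, commute z y.
  elim=> {y} [z|_ [a [b [_ _ ->]]] z|y t _ cy _ ct z|y _ cy z].
  - exact: commute1.
  - by apply/commgP/eqP/N_class2.
  - exact: commuteM.
  - exact: commuteV.
elim=> {x} [//|_ [a [b [_ /C Cb ->]]]|x y _ -> _ ->|x _ ->].
- by apply/eqP/commgP.
- exact: mulg1.
- exact: invg1.
Qed.

Section Lift.
Variable f : 'I_n -> N.

Lemma N_lift_proof a : gamma3 a -> free_lift f a = 1.
Proof. by move=> /(gamma3_image (free_lift f)) /N_gamma3. Qed.

Definition N_lift : N -> N := quo_lift (A := @gamma3 _) (free_lift f).
HB.instance Definition _ :=
  isMultiplicative.Build _ _ N_lift (quo_lift_morph N_lift_proof).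
HB.instance Definition _ :=
  Multiplicative_isUMagmaMorphism.Build _ _ N_lift (quo_lift1 N_lift_proof).

Lemma N_lift_gen i : N_lift (N_gen i) = f i.
Proof. exact: etrans (quo_liftE N_lift_proof _) (free_lift_gen _ _). Qed.
End Lift.

Lemma N_ext (H : groupType) (f g : UMagmaMorphism.type N H) :
  (forall i, f (N_gen i) = g (N_gen i)) -> f =1 g.
Proof.
move=> fg x; have [u <-] := quo_pi_surj x; rewrite -[u]reprK free_wordE.
rewrite /word_eval; elim: (repr u) => [|[i b] w IH].
  by rewrite big_nil !gmulf1.
rewrite big_cons !gmulfM IH; congr (_ * _).
case: b => /=; first exact: fg.
by rewrite 3!gmulfV; congr (_^-1); exact: fg.
Qed.
End Nilpotent.

Section UVB.
Variable n : nat.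

(* Indices start from 0: the generators sigma_(i+1) and rho_(i+1) involve the
   positions lo i = i and hi i = i+1 of 'I_n. *)
Definition lo (i : 'I_n.-1) : 'I_n := widen_ord (leq_pred n) i.

Lemma hi_proof (i : 'I_n.-1) : (i.+1 < n)%N.
Proof. by move: n i => [[]//|m i] /=; rewrite ltnS. Qed.
Definition hi (i : 'I_n.-1) : 'I_n := Ordinal (hi_proof i).

Definition uvb_gen := ('I_n.-1 + 'I_n.-1)%type.
Definition free_sigma (i : 'I_n.-1) : free_group uvb_gen := free_gen (inl i).
Definition free_rho (i : 'I_n.-1) : free_group uvb_gen := free_gen (inr i).

Local Notation s := free_sigma.
Local Notation r := free_rho.

Definition consecutive (i j : 'I_n.-1) := j = i.+1 :> nat.
Definition far (i j : 'I_n.-1) := (i.+1 < j)%N \/ (j.+1 < i)%N.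

Inductive uvb_rel : free_group uvb_gen -> free_group uvb_gen -> Prop :=
| uvbR1 i j : consecutive i j -> uvb_rel (s i * s j * s i) (s j * s i * s j)
| uvbR2 i j : far i j -> uvb_rel (s i * s j) (s j * s i)
| uvbR3 i j : consecutive i j -> uvb_rel (r i * r j * r i) (r j * r i * r j)
| uvbR4 i j : far i j -> uvb_rel (r i * r j) (r j * r i)
| uvbR5 i : uvb_rel (r i ^+ 2) 1
| uvbR6 i j : far i j -> uvb_rel (s i * r j) (r j * s i)
| uvbM i j : consecutive i j -> uvb_rel (r i * r j * s i) (s j * r i * r j)
| uvbF1 i j : consecutive i j -> uvb_rel (r i * s j * s i) (s j * s i * r j)
| uvbF2 i j : consecutive i j -> uvb_rel (r j * s i * s j) (s i * s j * r i).

Definition UVB : groupType := presented uvb_rel.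

Definition sigma (i : 'I_n.-1) : UVB := quo_pi _ (s i).
Definition rho (i : 'I_n.-1) : UVB := quo_pi _ (r i).

Local Notation x := (@N_gen n).

Definition sigma_img (i : 'I_n.-1) (k : 'I_n) : N n :=
  if k == lo i then x (lo i) * x (hi i) * (x (lo i))^-1
  else if k == hi i then x (lo i) else x k.

Definition sigma_inv_img (i : 'I_n.-1) (k : 'I_n) : N n :=
  if k == lo i then x (hi i)
  else if k == hi i then (x (hi i))^-1 * x (lo i) * x (hi i) else x k.

Definition rho_img (i : 'I_n.-1) (k : 'I_n) : N n :=
  if k == lo i then x (hi i) else if k == hi i then x (lo i) else x k.

Lemma hi_lo i : (hi i == lo i) = false.
Proof. by rewrite -val_eqE /= gtn_eqF. Qed.

Lemma lift_cancel (f g : 'I_n -> N n) :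
  (forall k, N_lift g (f k) = x k) -> cancel (N_lift f) (N_lift g).
Proof.
move=> fg; apply: (@N_ext _ _ (N_lift g \o N_lift f) idfun) => k /=.
by rewrite N_lift_gen fg.
Qed.

Lemma lift_aut (f g : 'I_n -> N n) :
    (forall k, N_lift g (f k) = x k) -> (forall k, N_lift f (g k) = x k) ->
  is_aut (N_lift f).
Proof.
move=> fg gf; apply/asboolP; split; first exact: gmulfM.
by exists (N_lift g); exact: lift_cancel.
Qed.

Lemma sigma_aut_proof i : is_aut (N_lift (sigma_img i)).
Proof.
apply: (@lift_aut _ (sigma_inv_img i)) => k.
- rewrite /sigma_img; case: (k =P lo i) => [->|/eqP kl].
    rewrite gmulfM gmulfV gmulfM /= !N_lift_gen /sigma_inv_img eqxx hi_lo eqxx.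
    by rewrite !mulgA mulgV mul1g mulgK.
  case: (k =P hi i) => [->|/eqP kh].
    by rewrite N_lift_gen /sigma_inv_img eqxx.
  by rewrite N_lift_gen /sigma_inv_img (negPf kl) (negPf kh).
- rewrite /sigma_inv_img; case: (k =P lo i) => [->|/eqP kl].
    by rewrite N_lift_gen /sigma_img hi_lo eqxx.
  case: (k =P hi i) => [->|/eqP kh].
    rewrite gmulfM gmulfM gmulfV /= !N_lift_gen /sigma_img eqxx hi_lo eqxx.
    by rewrite !mulgA mulVg mul1g mulgVK.
  by rewrite N_lift_gen /sigma_img (negPf kl) (negPf kh).
Qed.

Definition sigma_aut i : aut (N n) := Aut (sigma_aut_proof i).

Lemma rho_aut_proof i : is_aut (N_lift (rho_img i)).
Proof.
by apply: (@lift_aut _ (rho_img i)) => k;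
  rewrite {2}/rho_img; case: (k =P lo i) => [->|/eqP kl];
  rewrite ?N_lift_gen /rho_img ?hi_lo ?eqxx //;
  case: (k =P hi i) => [->|/eqP kh];
  rewrite N_lift_gen ?eqxx // (negPf kl) (negPf kh).
Qed.

Definition rho_aut i : aut (N n) := Aut (rho_aut_proof i).

Definition gen_aut (g : uvb_gen) : aut (N n) :=
  match g with inl i => sigma_aut i | inr i => rho_aut i end.

Lemma sigma_lo i : sigma_aut i (x (lo i)) = x (lo i) * x (hi i) * (x (lo i))^-1.
Proof. by rewrite /= N_lift_gen /sigma_img eqxx. Qed.
Lemma sigma_hi i : sigma_aut i (x (hi i)) = x (lo i).
Proof. by rewrite /= N_lift_gen /sigma_img hi_lo eqxx. Qed.
Lemma sigma_ne i k : k != lo i -> k != hi i -> sigma_aut i (x k) = x k.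
Proof.
by move=> /negPf kl /negPf kh; rewrite /= N_lift_gen /sigma_img kl kh.
Qed.
Lemma rho_lo i : rho_aut i (x (lo i)) = x (hi i).
Proof. by rewrite /= N_lift_gen /rho_img eqxx. Qed.
Lemma rho_hi i : rho_aut i (x (hi i)) = x (lo i).
Proof. by rewrite /= N_lift_gen /rho_img hi_lo eqxx. Qed.
Lemma rho_ne i k : k != lo i -> k != hi i -> rho_aut i (x k) = x k.
Proof.
by move=> /negPf kl /negPf kh; rewrite /= N_lift_gen /rho_img kl kh.
Qed.

Lemma aut_ext (a b : aut (N n)) : (forall k, a (x k) = b (x k)) -> a = b.
Proof. by move=> ab; apply/autP/N_ext. Qed.

Lemma conj_swap (u v w : N n) :
  u * v * w * v^-1 * u^-1 = v * u * w * u^-1 * v^-1.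
Proof.
have uv : u * v = v * u * [~ u, v] by rewrite commgC.
have c : commute w [~ u, v] by apply/commgP/eqP/N_class2.
transitivity (u * v * w * (u * v)^-1); first by rewrite invgM !mulgA.
transitivity (v * u * w * (v * u)^-1); last by rewrite invgM !mulgA.
by move: uv c; set z := [~ u, v] => -> c; rewrite -(mulgA _ _ w) -c invgM;
  rewrite mulgA mulgA mulgK.
Qed.

Section Relations.
Variables i j : 'I_n.-1.

Hypothesis ij : consecutive i j.

Let lj : lo j = hi i. Proof. by apply: val_inj. Qed.
Let d1 : (lo i == hi i) = false.
Proof. by rewrite eq_sym hi_lo. Qed.
Let d2 : (hi j == hi i) = false.
Proof. by rewrite -lj hi_lo. Qed.
Let d3 : (hi j == lo i) = false.
Proof.
by rewrite -val_eqE /= ij; apply/negbTE; rewrite neq_ltn ltnS leqnSn orbT.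
Qed.

Let si_l := sigma_lo i.
Let si_h := sigma_hi i.
Let si_c : sigma_aut i (x (hi j)) = x (hi j).
Proof. by apply: sigma_ne; rewrite ?d2 ?d3. Qed.
Let sj_l : sigma_aut j (x (hi i)) = x (hi i) * x (hi j) * (x (hi i))^-1.
Proof. by rewrite -lj sigma_lo. Qed.
Let sj_h : sigma_aut j (x (hi j)) = x (hi i).
Proof. by rewrite -lj sigma_hi. Qed.
Let sj_c : sigma_aut j (x (lo i)) = x (lo i).
Proof. by apply: sigma_ne; rewrite ?lj 1?eq_sym ?hi_lo ?d3. Qed.
Let ri_l := rho_lo i.
Let ri_h := rho_hi i.
Let ri_c : rho_aut i (x (hi j)) = x (hi j).
Proof. by apply: rho_ne; rewrite ?d2 ?d3. Qed.
Let rj_l : rho_aut j (x (hi i)) = x (hi j).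
Proof. by rewrite -lj rho_lo. Qed.
Let rj_h : rho_aut j (x (hi j)) = x (hi i).
Proof. by rewrite -lj rho_hi. Qed.
Let rj_c : rho_aut j (x (lo i)) = x (lo i).
Proof. by apply: rho_ne; rewrite ?lj 1?eq_sym ?hi_lo ?d3. Qed.

Let vals := (si_l, si_h, si_c, sj_l, sj_h, sj_c, ri_l, ri_h, ri_c, rj_l, rj_h,
  rj_c).

Let other k a b c : k != lo i -> k != hi i -> k != hi j ->
  a \in [:: sigma_aut i; sigma_aut j; rho_aut i; rho_aut j] ->
  b \in [:: sigma_aut i; sigma_aut j; rho_aut i; rho_aut j] ->
  c \in [:: sigma_aut i; sigma_aut j; rho_aut i; rho_aut j] ->
  (a * b * c) (x k) = x k.
Proof.
move=> k1 k2 k3.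
have E a' : a' \in [:: sigma_aut i; sigma_aut j; rho_aut i; rho_aut j] ->
    a' (x k) = x k.
  rewrite !inE => /or4P[] /eqP ->; rewrite ?sigma_ne ?rho_ne // ?lj //.
by move=> /E Ea /E Eb /E Ec; rewrite !aut_mulE Ea Eb Ec.
Qed.

Let ext3 a b c d e f :
  all [in [:: sigma_aut i; sigma_aut j; rho_aut i; rho_aut j]]
    [:: a; b; c; d; e; f] ->
  (a * b * c) (x (lo i)) = (d * e * f) (x (lo i)) ->
  (a * b * c) (x (hi i)) = (d * e * f) (x (hi i)) ->
  (a * b * c) (x (hi j)) = (d * e * f) (x (hi j)) ->
  a * b * c = d * e * f.
Proof.
move=> /and5P[ha hb hc hd /andP[he /andP[hf _]]] e1 e2 e3; apply: aut_ext => k.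
have [->//|k1] := eqVneq k (lo i); have [->//|k2] := eqVneq k (hi i).
have [->//|k3] := eqVneq k (hi j).
by rewrite !other.
Qed.

Let autE := (vals, @autM (N n), @autV (N n)).

Ltac autsolve :=
  apply: ext3; [by rewrite /= !inE !eqxx ?orbT | | |];
  rewrite !aut_mulE; do 6 rewrite ?autE;
  rewrite ?invgM ?invgK ?mulgA ?mulgVK ?mulgK.

Lemma gen_autR1 : sigma_aut i * sigma_aut j * sigma_aut i =
  sigma_aut j * sigma_aut i * sigma_aut j.
Proof. by autsolve. Qed.

Lemma gen_autR3 :
  rho_aut i * rho_aut j * rho_aut i = rho_aut j * rho_aut i * rho_aut j.
Proof. by autsolve. Qed.

Lemma gen_autM :
  rho_aut i * rho_aut j * sigma_aut i = sigma_aut j * rho_aut i * rho_aut j.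
Proof. by autsolve. Qed.

Lemma gen_autF1 :
  rho_aut i * sigma_aut j * sigma_aut i = sigma_aut j * sigma_aut i * rho_aut j.
Proof. by autsolve. Qed.

Lemma gen_autF2 :
  rho_aut j * sigma_aut i * sigma_aut j = sigma_aut i * sigma_aut j * rho_aut i.
Proof.
autsolve => //.
rewrite -[RHS]conj_swap //.
Qed.
End Relations.

Lemma gen_autR5 i : rho_aut i ^+ 2 = 1.
Proof.
apply: aut_ext => k; rewrite expg2 aut_mulE.
have [->|kl] := eqVneq k (lo i); first by rewrite rho_lo rho_hi.
have [->|kh] := eqVneq k (hi i); first by rewrite rho_hi rho_lo.
by rewrite !rho_ne.
Qed.

Definition supported (a : aut (N n)) (i : 'I_n.-1) :=
  (forall k, k != lo i -> k != hi i -> a (x k) = x k) /\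
  (forall b : aut (N n), b (x (lo i)) = x (lo i) -> b (x (hi i)) = x (hi i) ->
    forall k, (k == lo i) || (k == hi i) -> b (a (x k)) = a (x k)).

Lemma sigma_supported i : supported (sigma_aut i) i.
Proof.
split=> [k|b bl bh k /orP[] /eqP ->]; first exact: sigma_ne.
- by rewrite sigma_lo !autM autV bl bh.
- by rewrite sigma_hi bl.
Qed.

Lemma rho_supported i : supported (rho_aut i) i.
Proof.
split=> [k|b bl bh k /orP[] /eqP ->]; first exact: rho_ne.
- by rewrite rho_lo bh.
- by rewrite rho_hi bl.
Qed.

Lemma far_commute i j a b : far i j -> supported a i -> supported b j ->
  a * b = b * a.
Proof.
move=> ij [a1 a2] [b1 b2].
have D : [&& lo i != lo j, lo i != hi j, hi i != lo j & hi i != hi j].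
  by rewrite -!val_eqE /=; move: ij; rewrite /far; lia.
case/and4P: D => d1 d2 d3 d4; apply: aut_ext => k; rewrite !aut_mulE.
have [ki|] := boolP ((k == lo i) || (k == hi i)).
  rewrite a2 ?b1 //; case/orP: ki => /eqP -> //.
rewrite negb_or => /andP[k1 k2]; rewrite (a1 k) //.
have [kj|] := boolP ((k == lo j) || (k == hi j)).
  by rewrite b2 // a1 // eq_sym.
by rewrite negb_or => /andP[k3 k4]; rewrite !b1 // a1.
Qed.

Lemma gen_aut_rel l r : uvb_rel l r ->
  free_lift gen_aut l = free_lift gen_aut r.
Proof.
have L2 a b : free_lift gen_aut (free_gen a * free_gen b) =
    gen_aut a * gen_aut b by rewrite gmulfM /= !free_lift_gen.
have L3 a b c : free_lift gen_aut (free_gen a * free_gen b * free_gen c) =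
    gen_aut a * gen_aut b * gen_aut c by rewrite gmulfM /= L2 free_lift_gen.
have S := sigma_supported; have T := rho_supported.
case=> [i j|i j|i j|i j|i|i j|i j|i j|i j] => [ij|ij|ij|ij||ij|ij|ij|ij].
- rewrite !L3; exact: gen_autR1.
- rewrite !L2; exact: far_commute ij (S i) (S j).
- rewrite !L3; exact: gen_autR3.
- rewrite !L2; exact: far_commute ij (T i) (T j).
- rewrite expg2 L2 -expg2 [RHS]free_lift1; exact: gen_autR5.
- rewrite !L2; exact: far_commute ij (S i) (T j).
- rewrite !L3; exact: gen_autM.
- rewrite !L3; exact: gen_autF1.
- rewrite !L3; exact: gen_autF2.
Qed.

Lemma phi_proof g : relators uvb_rel g -> free_lift gen_aut g = 1.
Proof.
by move=> [l [r [lr ->]]]; rewrite gmulfM gmulfV /= (gen_aut_rel lr) mulgV.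
Qed.

Definition phi : UVB -> aut (N n) :=
  quo_lift (A := relators uvb_rel) (free_lift gen_aut).
HB.instance Definition _ :=
  isMultiplicative.Build UVB (aut (N n)) phi (quo_lift_morph phi_proof).
HB.instance Definition _ :=
  Multiplicative_isUMagmaMorphism.Build UVB (aut (N n)) phi
    (quo_lift1 phi_proof).

Lemma phi_sigma i : phi (sigma i) = sigma_aut i.
Proof. exact: etrans (quo_liftE phi_proof _) (free_lift_gen _ _). Qed.

Lemma phi_rho i : phi (rho i) = rho_aut i.
Proof. exact: etrans (quo_liftE phi_proof _) (free_lift_gen _ _). Qed.

Lemma phiM b c z : phi (b * c) z = phi c (phi b z).
Proof. by rewrite gmulfM. Qed.
End UVB.

Inductive link_group_rel n (u : 'I_n -> free_group 'I_n) :
    free_group 'I_n -> free_group 'I_n -> Prop :=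
| link_fix i : link_group_rel u (u i) (free_gen i)
| link_nil i k l :
    link_group_rel u [~ free_gen i, [~ free_gen k, free_gen l]] 1.

(* G(beta), where u i is a word representing phi beta (x_i). *)
Definition fused_link_group n (u : 'I_n -> free_group 'I_n) : groupType :=
  presented (link_group_rel u).

Definition represents n (b : UVB n) (u : 'I_n -> free_group 'I_n) :=
  forall i, N_pi (u i) = phi b (N_gen i).

Definition isomorphic (G H : groupType) :=
  exists f : {multiplicative G -> H}, bijective f.

Inductive crossing := Positive | Negative | Virtual.

(* A braid-like diagram, read as the list of its crossings: (c, i) is a
   crossing of type c between the strands in positions lo i and hi i, so that
   sigma, sigma^-1 and rho are Positive, Negative and Virtual respectively. *)
Definition braid_word n := seq (crossing * 'I_n.-1).

Definition letter_eval n (l : crossing * 'I_n.-1) : UVB n :=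
  match l.1 with
  | Positive => sigma l.2
  | Negative => (sigma l.2)^-1
  | Virtual => rho l.2
  end.

Definition braid_eval n (w : braid_word n) : UVB n :=
  \prod_(l <- w) letter_eval l.

(* The position, after the crossings of w, of the strand that starts in
   position k. *)
Definition position n (w : braid_word n) (k : 'I_n) : 'I_n :=
  foldl (fun p (l : crossing * 'I_n.-1) =>
    if p == lo l.2 then hi l.2 else if p == hi l.2 then lo l.2 else p) k w.

Local Close Scope group_scope.
Local Open Scope ring_scope.

Section Curves.
Variables (R : realType) (k : nat) (g : 'I_k -> R -> R * R).

(* The 1-manifold is 'I_k x R/Z; its points are represented in 'I_k x R. *)
Definition same_point (p q : 'I_k * R) :=
  p.1 = q.1 /\ exists z : int, q.2 = p.2 + z%:~R.

Definition at_point (p : 'I_k * R) : R * R := g p.1 p.2.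

Definition meet (p q : 'I_k * R) :=
  ~ same_point p q /\ at_point p = at_point q.

Definition velocity (p : 'I_k * R) : R * R := derive1 (g p.1) p.2.
End Curves.

Definition det2 (R : realType) (v w : R * R) : R := v.1 * w.2 - v.2 * w.1.

Record diagram (R : realType) := Diagram {
  ncomp : nat;
  curve : 'I_ncomp -> R -> R * R;
  (* only relevant at the double points *)
  mark : R * R -> crossing;
  curve_periodic : forall i t, curve i (t + 1) = curve i t;
  curve_smooth : forall i j t, derivable (derive1n j (curve i)) t 1;
  curve_immersed : forall i t, derive1 (curve i) t != 0;
  curve_transverse : forall p q, meet curve p q ->
    det2 (velocity curve p) (velocity curve q) != 0;
  curve_double : forall p q r, meet curve p q -> meet curve p r ->
    same_point q r;
  (* automatic, by compactness *)
  curve_finite :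
    finite_set [set at_point curve p | p in [set p | exists q, meet curve p q]]
}.

Arguments curve {R} d _ _.

Section Diagrams.
Variable R : realType.
Local Notation diagram := (diagram R).
Local Notation point D := ('I_(ncomp D) * R)%type.

(* p passes over q: a classical crossing is positive when the pair of
   directions (over strand, under strand) is a positively oriented basis. *)
Definition over (D : diagram) (p q : point D) : Prop :=
  meet (curve D) p q /\
  let d := det2 (velocity (curve D) p) (velocity (curve D) q) in
  match mark D (at_point (curve D) p) with
  | Positive => 0 < d
  | Negative => d < 0
  | Virtual => False
  end.

Definition homeomorphism (f : R * R -> R * R) :=
  continuous f /\ exists g, [/\ continuous g, cancel f g & cancel g f].

Definition ambient_isotopy (H : R -> R * R -> R * R) :=
  [/\ {within [set p : R * (R * R) | 0 <= p.1 <= 1],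
        continuous (fun p => H p.1 p.2)},
      H 0 =1 id &
      forall t, 0 <= t <= 1 -> homeomorphism (H t)].

(* tau is an orientation-preserving reparametrization. The preservation of
   over/under follows from that of the marks, as H 1 preserves the orientation
   of the plane. *)
Definition isotopic (D D' : diagram) :=
  exists (H : R -> R * R -> R * R) (e : 'I_(ncomp D) -> 'I_(ncomp D'))
      (tau : 'I_(ncomp D) -> R -> R),
  let f (p : point D) : point D' := (e p.1, tau p.1 p.2) in
  [/\ ambient_isotopy H, bijective e,
      (forall i, [/\ continuous (tau i), {homo tau i : s t / s < t} &
         forall t, tau i (t + 1) = tau i t + 1]),
      (forall i t, curve D' (e i) (tau i t) = H 1 (curve D i t)) &
      forall p q, meet (curve D) p q ->
        mark D' (H 1 (at_point (curve D) p)) =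
          mark D (at_point (curve D) p) /\
        (over p q <-> over (f p) (f q))].

Definition closed_disk (B : set (R * R)) :=
  exists f, homeomorphism f /\
    B = f @` [set p : R * R | p.1 ^+ 2 + p.2 ^+ 2 <= 1].

Section Arcs.
Variables (D : diagram) (r : nat).
Variables (c : 'I_r -> 'I_(ncomp D)) (a b : 'I_r -> R).

(* The arcs of D given by the parameters [a k, b k] on the components c k are
   pairwise disjoint in the 1-manifold, their union is the preimage of B,
   they are properly embedded in B near their endpoints, and no double point
   lies on the boundary of B. *)
Definition disk_arcs (B : set (R * R)) :=
  [/\ forall k, a k < b k < a k + 1,
      forall k l s t, a k <= s <= b k -> a l <= t <= b l ->
        same_point (c k, s) (c l, t) -> k = l,
      forall p, B (at_point (curve D) p) <->
        exists k t, a k <= t <= b k /\ same_point p (c k, t),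
      forall k t, a k <= t <= b k ->
        (B° (curve D (c k) t) <-> a k < t < b k) &
      forall p q, meet (curve D) p q -> B (at_point (curve D) p) ->
        B° (at_point (curve D) p)].

Definition arcs_meet (k : 'I_r) (s : R) (l : 'I_r) (t : R) :=
  [/\ a k < s < b k, a l < t < b l & meet (curve D) (c k, s) (c l, t)].

Definition arcs_over (k : 'I_r) (s : R) (l : 'I_r) (t : R) :=
  over (c k, s) (c l, t).

Definition arc_mark (k : 'I_r) (s : R) := mark D (curve D (c k) s).

Definition no_crossing := forall k s l t, ~ arcs_meet k s l t.

End Arcs.

(* The local moves below are described by what the diagrams look like inside a
   disk B. The endpoints of the arcs are the same for D and D', so by the
   Jordan-Schoenflies theorem the stated crossing patterns determine both
   pictures up to an isotopy of B: they are the usual pictures of the moves. *)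
Definition same_outside (D D' : diagram) (B : set (R * R))
    (e : 'I_(ncomp D) -> 'I_(ncomp D')) r (c : 'I_r -> 'I_(ncomp D))
    (a b : 'I_r -> R) :=
  [/\ closed_disk B, bijective e,
      disk_arcs c a b B /\ disk_arcs (e \o c) a b B,
      forall i t, ~ B° (curve D i t) -> curve D' (e i) t = curve D i t &
      forall p q, meet (curve D) p q -> ~ B (at_point (curve D) p) ->
        mark D' (at_point (curve D) p) = mark D (at_point (curve D) p)].

(* Type I, classical or virtual: an arc without crossings is replaced by an arc
   with exactly one crossing (with itself). *)
Definition reidemeister1 (D D' : diagram) :=
  exists B e (c : 'I_1 -> 'I_(ncomp D)) (a b : 'I_1 -> R),
  [/\ @same_outside D D' B e 1 c a b,
      no_crossing c a b &
      exists s t, s < t /\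
        forall k u l v, u < v ->
          (arcs_meet (e \o c) a b k u l v <-> u = s /\ v = t)].

(* Type II, classical or virtual: two arcs without crossings are replaced by two
   arcs that cross exactly twice. In the classical case, one of the arcs is over
   the other at both crossings (which then have opposite signs). *)
Definition reidemeister2 (D D' : diagram) :=
  exists B e (c : 'I_2 -> 'I_(ncomp D)) (a b : 'I_2 -> R),
  let c' := e \o c in
  [/\ @same_outside D D' B e 2 c a b,
      no_crossing c a b &
      exists s t : 'I_2 -> R, let k : 'I_2 := ord0 in let l : 'I_2 := ord_max in
      [/\ s k < t k,
          forall j u v, ~ arcs_meet c' a b j u j v,
          forall u v, arcs_meet c' a b k u l v <->
            (u = s k /\ v = s l) \/ (u = t k /\ v = t l) &
          (arc_mark c' k (s k) = Virtual /\ arc_mark c' k (t k) = Virtual) \/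
          ((arc_mark c' k (s k) = Positive /\ arc_mark c' k (t k) = Negative \/
            arc_mark c' k (s k) = Negative /\ arc_mark c' k (t k) = Positive) /\
           (arcs_over c' k (s k) l (s l) /\ arcs_over c' k (t k) l (t l) \/
            arcs_over c' l (s l) k (s k) /\ arcs_over c' l (t l) k (t k)))]].

(* Type III: three arcs that cross pairwise exactly once, at s k l on the arc k
   and s l k on the arc l; the move reverses the order of the two crossings on
   each arc. The moving arc k crosses the other two arcs virtually twice, or
   passes over both, or under both; the remaining crossing is arbitrary. This
   covers exactly:
   - the classical move (three classical crossings);
   - the virtual move (three virtual crossings);
   - the mixed move (k virtual, the remaining crossing classical);
   - the two forbidden moves (k over, respectively under, the remaining crossing
     virtual). *)
Definition reidemeister3 (D D' : diagram) :=
  exists B e (c : 'I_3 -> 'I_(ncomp D)) (a b : 'I_3 -> R),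
  let c' := e \o c in
  @same_outside D D' B e 3 c a b /\
  exists s s' : 'I_3 -> 'I_3 -> R,
  [/\ forall k u l v, arcs_meet c a b k u l v <->
        [/\ k != l, u = s k l & v = s l k],
      forall k u l v, arcs_meet c' a b k u l v <->
        [/\ k != l, u = s' k l & v = s' l k],
      forall k l m, k != l -> k != m -> l != m ->
        (s k l < s k m <-> s' k m < s' k l),
      forall k l, k != l ->
        arc_mark c' k (s' k l) = arc_mark c k (s k l) /\
        (arcs_over c' k (s' k l) l (s' l k) <->
         arcs_over c k (s k l) l (s l k)) &
      exists k,
        [\/ forall l, l != k -> arc_mark c k (s k l) = Virtual,
            forall l, l != k -> arcs_over c k (s k l) l (s l k) |
            forall l, l != k -> arcs_over c l (s l k) k (s k l)]].

Inductive fused_step (D D' : diagram) : Prop :=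
| step_isotopy of isotopic D D'
| step_reidemeister1 of reidemeister1 D D'
| step_reidemeister2 of reidemeister2 D D'
| step_reidemeister3 of reidemeister3 D D'.

Definition fused_isotopic : diagram -> diagram -> Prop :=
  clos_refl_sym_trans diagram fused_step.

(* The closure of the braid-like diagram w, drawn around the origin: the
   strands turn counterclockwise, the position of a strand being its rank in
   the order of increasing distances to the origin, i.e. from left to right.
   The component i makes turns i turns at constant speed and lies at distance
   rad i t of the origin; the strand k is the (m k)-th turn of the component
   c k. The crossings of w occur at the angles 2 pi u for u in theta; the sector
   between the last one and the first one contains the n parallel closing
   arcs. *)
Definition is_closure n (w : braid_word n) (D : diagram) :=
  exists (turns : 'I_(ncomp D) -> nat) (rad : 'I_(ncomp D) -> R -> R)
         (c : 'I_n -> 'I_(ncomp D)) (m : 'I_n -> nat) (theta : seq R),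
  let angle i t := 2 * pi * (turns i)%:R * t in
  let param k u := ((m k)%:R + u) / (turns (c k))%:R in
  let dist k u := rad (c k) (param k u) in
  let crossed u := take (count (fun x => x < u) theta) w in
  [/\ forall i t, [/\ (0 < turns i)%N, 0 < rad i t &
        curve D i t = (rad i t * cos (angle i t), rad i t * sin (angle i t))],
      (forall k, (m k < turns (c k))%N) /\
      (forall i j, (j < turns i)%N -> exists! k, c k = i /\ m k = j),
      [/\ size theta = size w, sorted <%R theta &
          forall x, x \in theta -> 0 < x < 1],
      forall u k l, 0 <= u <= 1 -> u \notin theta ->
        (dist k u < dist l u <->
         (position (crossed u) k < position (crossed u) l)%N) &
      forall w1 x i w2, w = w1 ++ (x, i) :: w2 ->
        let u := nth 0 theta (size w1) in
        (forall k l, k != l -> (dist k u = dist l u <->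
           (position w1 k = lo i /\ position w1 l = hi i) \/
           (position w1 k = hi i /\ position w1 l = lo i))) /\
        (forall k, position w1 k = lo i ->
           mark D (curve D (c k) (param k u)) = x)].

Definition closure_of n (b : UVB n) (D : diagram) :=
  exists w : braid_word n, braid_eval w = b /\ is_closure w D.
End Diagrams.

(* Main.v *)
(* In a group of nilpotency class 2, conjugation by g only depends on the image
   of g in the abelianization. Following the strands of a closed braid, the
   generators of G(beta) are therefore conjugates of one meridian y_i per
   component by explicit words in the meridians, and G(beta) is presented, among
   groups of class 2, by the relations saying that y_i commutes with the product
   of the y_j^lk(i,j), where lk(i,j) is the sum of the signs of the crossings at
   which the component i passes over the component j. (With the conventions for
   phi, it is the over strand whose meridian gets conjugated.) As y_i commutes
   with itself, lk(i,i) is irrelevant.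

   For i <> j the number lk(i,j) is invariant under fused isotopy: a plane
   isotopy carries crossings to crossings, a move of type I only creates a
   self-crossing, a classical move of type II creates two crossings with opposite signs and the
   same over strand, and a move of type III matches the crossings before and
   after the move. Only the crossing data inside the disk of the move matter, so
   no planar topology is needed. *)

From HB Require Import structures.
From mathcomp Require Import all_boot all_order all_algebra.
From mathcomp Require Import zify ring lra.
From mathcomp Require Import all_classical all_reals all_analysis.
Require Import Defs.
Set Implicit Arguments.
Unset Strict Implicit.
Unset Printing Implicit Defensive.
Import Order.TTheory GRing.Theory Num.Theory.
Import numFieldNormedType.Exports.

Local Open Scope classical_set_scope.
Local Open Scope group_scope.

(** * Groups of nilpotency class 2 *)

Section IntPowers.
Variable G : groupType.
Implicit Types (x y g h : G) (a b z : int).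

Definition expz x z : G :=
  match z with Posz k => x ^+ k | Negz k => x ^- k.+1 end.

Lemma expz1 x : expz x 1 = x. Proof. by []. Qed.

Lemma expzS x z : expz x (z + 1)%R = expz x z * x.
Proof.
case: z => [k|[|k]]; first by rewrite -PoszD addn1 /= expgSr.
  by rewrite /= mulVg.
have -> : (Negz k.+1 + 1)%R = Negz k by rewrite !NegzE; lia.
by rewrite /= [x ^+ k.+2]expgS invgM mulgVK.
Qed.

Lemma expzD x a b : expz x (a + b)%R = expz x a * expz x b.
Proof.
have expzP c : expz x (c - 1)%R = expz x c * x^-1.
  by rewrite -[in RHS](subrK 1%R c) expzS mulgK.
elim/int_rect: b => [|k IH|k IH]; first by rewrite addr0 mulg1.
  by rewrite -addn1 PoszD addrA !expzS IH mulgA.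
by rewrite -addn1 PoszD opprD addrA !expzP IH mulgA.
Qed.

Lemma expzN x a : expz x (- a)%R = (expz x a)^-1.
Proof. by apply/esym/mulg1_eq; rewrite -expzD subrr. Qed.

Lemma conj_expz x z : x ^ expz x z = x.
Proof.
apply/conjg_fixP; case: z => k /=; first by rewrite commgXg.
by rewrite commgXVg.
Qed.
End IntPowers.

Lemma gmulf_expz (G H : groupType) (f : UMagmaMorphism.type G H) x z :
  f (expz x z) = expz (f x) z.
Proof. by case: z => k; [exact: gmulfXn|exact: gmulfXVn]. Qed.

Definition class2 (G : groupType) := forall x y z : G, [~ x, [~ y, z]] = 1.

(** Equality modulo the centre, expressed through inner automorphisms. In class 2 it makes products
    commutative. *)
Definition same_conj (G : groupType) (g g' : G) := forall h : G, h ^ g = h ^ g'.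

Section Class2.
Variable G : groupType.
Hypothesis G2 : class2 G.
Implicit Types (g h x y : G) (K : finType).

Lemma same_conj_sym g h : same_conj g h -> same_conj h g.
Proof. by move=> gh x; rewrite gh. Qed.

Lemma same_conj_trans g h k :
  same_conj g h -> same_conj h k -> same_conj g k.
Proof. by move=> gh hk x; rewrite gh hk. Qed.

Lemma same_conjM g g' h h' :
  same_conj g g' -> same_conj h h' -> same_conj (g * h) (g' * h').
Proof. by move=> gg hh x; rewrite !conjgM gg hh. Qed.

Lemma same_conjV g g' : same_conj g g' -> same_conj g^-1 g'^-1.
Proof. by move=> gg x; apply: (conjg_inj g'); rewrite conjgKV -gg conjgKV. Qed.

Lemma same_conjX g g' k : same_conj g g' -> same_conj (g ^+ k) (g' ^+ k).
Proof.
move=> gg; elim: k => // k IH; rewrite !expgS; exact: same_conjM.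
Qed.

Lemma same_conj_expz g g' z : same_conj g g' -> same_conj (expz g z) (expz g' z).
Proof.
by move=> gg; case: z => k; [|apply: same_conjV]; exact: same_conjX.
Qed.

(** The two products differ by a commutator, which is central, so conjugation by it is trivial. *)
Lemma same_conjC g h : same_conj (g * h) (h * g).
Proof.
move=> x; rewrite commgC conjgM; apply/conjg_fixP/eqP/G2.
Qed.

Lemma same_conjJ g h : same_conj (g ^ h) g.
Proof.
move=> x; rewrite (_ : g ^ h = g * [~ g, h]); last by rewrite commgEl mulVKg.
by rewrite conjgM; apply/conjg_fixP/eqP/G2.
Qed.

(** The shape of a longitude written in meridians. The factors come in the enumeration order of [K],
    an arbitrary choice that disappears modulo the centre in class 2. *)
Definition zprod K (x : K -> G) (a : K -> int) : G :=
  \prod_(b : K) expz (x b) (a b).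

Lemma same_conj_prod (I : Type) (r : seq I) (F F' : I -> G) :
  (forall i, same_conj (F i) (F' i)) ->
  same_conj (\prod_(i <- r) F i) (\prod_(i <- r) F' i).
Proof.
move=> FF; elim: r => [|i r IH]; first by rewrite !big_nil.
by rewrite !big_cons; exact: same_conjM.
Qed.

Lemma same_conj_prodM (I : Type) (r : seq I) (F F' : I -> G) :
  same_conj (\prod_(i <- r) (F i * F' i))
    ((\prod_(i <- r) F i) * (\prod_(i <- r) F' i)).
Proof.
elim: r => [|i r IH]; first by rewrite !big_nil mulg1.
rewrite !big_cons.
apply: same_conj_trans (same_conjM (fun=> erefl) IH) _.
rewrite -!mulgA; apply: same_conjM => //.
by rewrite !mulgA; apply: same_conjM => //; exact: same_conjC.
Qed.

Lemma zprodD K (x : K -> G) a b :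
  same_conj (zprod x (fun k => a k + b k)%R) (zprod x a * zprod x b).
Proof.
apply: same_conj_trans; last exact: same_conj_prodM.
by apply: same_conj_prod => k; rewrite expzD.
Qed.

Lemma zprod0 K (x : K -> G) : zprod x (fun=> 0%R) = 1.
Proof. exact: big1. Qed.

Lemma zprodN K (x : K -> G) a :
  same_conj (zprod x (fun k => - a k)%R) (zprod x a)^-1.
Proof.
apply: same_conj_trans (_ : same_conj _
  (zprod x (fun k => - a k)%R * zprod x a * (zprod x a)^-1)) _.
  by rewrite mulgK.
rewrite -[X in same_conj _ X]mul1g; apply: same_conjM => //.
apply/same_conj_sym; apply: same_conj_trans (zprodD _ _ _).
by rewrite /zprod; under eq_bigr do rewrite addNr; rewrite big1.
Qed.

Lemma zprod_congr K (x y : K -> G) a :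
  (forall k, same_conj (x k) (y k)) -> same_conj (zprod x a) (zprod y a).
Proof. by move=> xy; apply: same_conj_prod => k; exact: same_conj_expz. Qed.

Lemma same_conj_perm (I : eqType) (r s : seq I) (F : I -> G) :
  perm_eq r s -> same_conj (\prod_(i <- r) F i) (\prod_(i <- s) F i).
Proof.
elim: r s => [|i r IH] s.
  by rewrite perm_sym => /perm_nilP ->.
move=> rs; have /path.splitPr E : i \in s by rewrite -(perm_mem rs) mem_head.
case: E rs => s1 s2; rewrite -[i :: s2]cat1s perm_sym perm_catCA perm_cons.
rewrite perm_sym => /IH {}IH; rewrite big_cons.
apply: same_conj_trans (same_conjM (fun=> erefl) IH) _.
rewrite !big_cat big_cons /= big_nil mulg1 !mulgA.
by apply: same_conjM => //; exact: same_conjC.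
Qed.

Lemma zprod_reindex K K' (f : K -> K') (x : K' -> G) a : bijective f ->
  same_conj (zprod x a) (zprod (x \o f) (a \o f)).
Proof.
move=> fb; rewrite /zprod -(big_map f xpredT (fun b => expz (x b) (a b))).
apply: same_conj_perm; apply: uniq_perm.
- exact: index_enum_uniq.
- by rewrite map_inj_uniq ?index_enum_uniq//; exact: bij_inj.
- move=> b; rewrite mem_index_enum; case: fb => g fg gf.
  by apply/esym/mapP; exists (g b); rewrite ?mem_index_enum ?gf.
Qed.

Lemma zprod_delta K (x : K -> G) k z :
  zprod x (fun l => if l == k then z else 0%R) = expz (x k) z.
Proof.
rewrite /zprod.
rewrite (eq_bigr (fun l => if l == k then expz (x k) z else 1)).
  by rewrite -big_mkcond big_const -/(#|pred1 k|) card1 /= mulg1.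
by move=> l _; case: eqVneq => [->|].
Qed.

(** Collects the exponents of all [l] over the same [k]; strands are grouped into components in this
    way. *)
Lemma zprod_fiber K K' (c : K -> K') (y : K' -> G) a :
  same_conj (zprod (y \o c) a)
    (zprod y (fun k => \sum_(l | c l == k) a l)%R).
Proof.
rewrite /zprod; elim: (index_enum K) => [|l r IH].
  by rewrite big_nil; under eq_bigr do rewrite big_nil; rewrite big1.
rewrite big_cons; apply/same_conj_sym.
(* [d] is the share of the head [l] of the list, concentrated at [c l]. *)
pose d k := if k == c l then a l else 0%R.
pose b k := (\sum_(i <- r | c i == k) a i)%R.
have -> : \prod_k expz (y k) (\sum_(i <- l :: r | c i == k) a i)%R =
    zprod y (fun k => d k + b k)%R.
  apply: eq_bigr => k _; rewrite big_cons /d [k == _]eq_sym.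
  by case: eqP; rewrite ?add0r.
apply: same_conj_trans (zprodD y _ _) _; apply: same_conjM.
  by rewrite zprod_delta.
exact/same_conj_sym.
Qed.

(** [y k] commutes with its own powers, so the exponent at [k] can be changed at will. This is what
    makes diagonal linking numbers irrelevant. *)
Lemma conj_zprod_off K (y : K -> G) (k : K) a b :
  (forall l, l != k -> a l = b l) -> y k ^ zprod y a = y k ^ zprod y b.
Proof.
move=> ab; pose d l := if l == k then (a k - b k)%R else 0%R.
have -> : a = (fun l => d l + b l)%R.
  apply/funext => l; rewrite /d; case: eqVneq => [->|/ab ->]; last by rewrite add0r.
  by rewrite subrK.
by rewrite zprodD conjgM zprod_delta conj_expz.
Qed.
End Class2.

Lemma gmulf_zprod (G H : groupType) (f : UMagmaMorphism.type G H) (K : finType)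
    (x : K -> G) a : f (zprod x a) = zprod (f \o x) a.
Proof. by rewrite /zprod gmulf_prod; under eq_bigr do rewrite gmulf_expz. Qed.

(** * Homomorphisms out of presented groups *)

Lemma free_ext (I : choiceType) (H : groupType)
    (f g : UMagmaMorphism.type (free_group I) H) :
  (forall i, f (free_gen i) = g (free_gen i)) -> f =1 g.
Proof.
move=> fg x; rewrite -[x]reprK free_wordE /word_eval.
elim: (repr x) => [|[i b] w IH]; first by rewrite big_nil !gmulf1.
rewrite big_cons !gmulfM IH; congr (_ * _).
by case: b => /=; rewrite ?gmulfV fg.
Qed.

Section Presentations.
Variables (I : choiceType) (E : free_group I -> free_group I -> Prop).

Definition presented_gen (i : I) : presented E := quo_pi _ (free_gen i).

Lemma presented_rel l r : E l r -> quo_pi (relators E) l = quo_pi (relators E) r.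
Proof.
move=> lr; apply/divg1_eq; rewrite -gmulfF; apply/quo_pi_eq1/nclosure_sub.
by exists l, r.
Qed.

Lemma quo_pi_free_lift x : quo_pi (relators E) x = free_lift presented_gen x.
Proof.
apply: (@free_ext _ _ (quo_pi (relators E)) (free_lift presented_gen)) => i.
by rewrite /= free_lift_gen.
Qed.

Section Lift.
Variables (H : groupType) (f : I -> H).
Hypothesis fE : forall l r, E l r -> free_lift f l = free_lift f r.

Lemma presented_lift_proof a : relators E a -> free_lift f a = 1.
Proof. by move=> [l [r [lr ->]]]; rewrite gmulfF /= (fE lr) mulgV. Qed.

Definition presented_lift : presented E -> H :=
  quo_lift (A := relators E) (free_lift f).
HB.instance Definition _ := isMultiplicative.Build _ _ presented_lift
  (quo_lift_morph presented_lift_proof).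
HB.instance Definition _ := Multiplicative_isUMagmaMorphism.Build _ _
  presented_lift (quo_lift1 presented_lift_proof).

Lemma presented_lift_exists :
  exists h : UMagmaMorphism.type (presented E) H,
    forall i, h (presented_gen i) = f i.
Proof.
exists presented_lift => i.
exact: etrans (quo_liftE presented_lift_proof _) (free_lift_gen _ _).
Qed.
End Lift.

Lemma presented_ext (H : groupType) (f g : UMagmaMorphism.type (presented E) H) :
  (forall i, f (presented_gen i) = g (presented_gen i)) -> f =1 g.
Proof.
move=> fg x; have [u <-] := quo_pi_surj x.
exact: (@free_ext _ _ (f \o quo_pi (relators E)) (g \o quo_pi (relators E))).
Qed.

(** With one entry fixed, the commutator is multiplicative in the other as long as its values are
    central, so centrality spreads from the generators to all elements, one entry at a time. *)
Lemma presented_class2 :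
  (forall i k l : I, [~ presented_gen i, [~ presented_gen k, presented_gen l]] = 1) ->
  class2 (presented E).
Proof.
move=> gen2.
have ind (P : presented E -> Prop) : P 1 ->
    (forall x y, P x -> P y -> P (x * y)) -> (forall x, P x -> P x^-1) ->
    (forall i, P (presented_gen i)) -> forall x, P x.
  move=> P1 PM PV Pg x; have [u <-] := quo_pi_surj x.
  rewrite -[u]reprK free_wordE /word_eval.
  elim: (repr u) => [|[i b] w IH]; first by rewrite big_nil gmulf1.
  rewrite big_cons gmulfM; apply: PM => //; case: b => /=; first exact: Pg.
  by rewrite gmulfV; apply: PV; exact: Pg.
pose central z := forall x : presented E, commute x z.
have centralP z : (forall i, commute (presented_gen i) z) -> central z.
  move=> cz; apply: ind => //.
  - exact/commute_sym/commute1.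
  - by move=> x y /commute_sym zx /commute_sym zy; apply/commute_sym/commuteM.
  - by move=> x /commute_sym zx; apply/commute_sym/commuteV.
have comm_central x : (forall i, central [~ presented_gen i, x]) ->
    forall y, central [~ y, x].
  move=> cx; apply: ind => //.
  - by rewrite comm1g => z; exact: commute1.
  - move=> y z cy cz.
    suff -> : [~ y * z, x] = [~ y, x] * [~ z, x] by move=> t; exact: commuteM.
    have E1 : [~ y * z, x] = [~ y, x] ^ z * [~ z, x].
      by rewrite !commgEl !conjgE !invgM !mulgA !mulgK.
    rewrite E1; congr (_ * _); rewrite conjgE -(cy z) mulKg //.
  - move=> y cy.
    suff -> : [~ y^-1, x] = [~ y, x]^-1 by move=> t; exact: commuteV.
    have E1 : [~ y^-1, x] = ([~ y, x]^-1) ^ (y^-1).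
      by rewrite !commgEl !conjgE !invgM !invgK !mulgA ?mulgK ?mulgVK.
    by rewrite E1 conjgE invgK mulgA (commuteV (cy y)) mulgK.
(* The first entry is made arbitrary, then the second; [invgR] exchanges the entries in between. *)
have genc i y : central [~ y, presented_gen i].
  apply: comm_central => k; apply: centralP => l; exact/commgP/eqP.
have allc x y : central [~ x, y].
  apply: comm_central => i; rewrite -invgR => z; apply: commuteV; exact: genc.
by move=> x y z; apply/eqP/commgP; exact: allc.
Qed.
End Presentations.

Section NilpotentHom.
Variables (n : nat) (G : groupType) (G2 : class2 G) (f : 'I_n -> G).

Lemma class2_gamma3 (x : G) : gamma3 x -> x = 1.
Proof.
have C (y : G) : commutator_subgroup setT setT y -> forall z, commute z y.
  elim=> {y} [z|_ [a [b [_ _ ->]]] z|y t _ cy _ ct z|y _ cy z].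
  - exact: commute1.
  - by apply/commgP/eqP/G2.
  - exact: commuteM.
  - exact: commuteV.
elim=> {x} [//|_ [a [b [_ /C Cb ->]]]|x y _ -> _ ->|x _ ->].
- by apply/eqP/commgP.
- exact: mulg1.
- exact: invg1.
Qed.

Lemma N_hom_proof a : gamma3 a -> free_lift f a = 1.
Proof. by move=> /(gamma3_image (free_lift f)) /class2_gamma3. Qed.

Definition N_hom : N n -> G := quo_lift (A := @gamma3 _) (free_lift f).
HB.instance Definition _ :=
  isMultiplicative.Build _ _ N_hom (quo_lift_morph N_hom_proof).
HB.instance Definition _ :=
  Multiplicative_isUMagmaMorphism.Build _ _ N_hom (quo_lift1 N_hom_proof).

(** [N n] is the free group of class 2: words representing the same element of [N n] take the same
    value in [G]. *)
Lemma N_hom_exists :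
  exists h : UMagmaMorphism.type (N n) G, forall u, h (N_pi u) = free_lift f u.
Proof. by exists N_hom => u; exact: (quo_liftE N_hom_proof). Qed.
End NilpotentHom.

(** * The group of a closed braid *)

Section BraidAction.
Variable n : nat.
Implicit Types (w : braid_word n) (l : crossing * 'I_n.-1) (p q k : 'I_n).

Definition step l p : 'I_n :=
  if p == lo l.2 then hi l.2 else if p == hi l.2 then lo l.2 else p.

Arguments step : simpl never.

Lemma step_lo l : step l (lo l.2) = hi l.2. Proof. by rewrite /step eqxx. Qed.
Lemma step_hi l : step l (hi l.2) = lo l.2.
Proof. by rewrite /step hi_lo eqxx. Qed.

Lemma stepK l : involutive (step l).
Proof.
move=> p; rewrite {2}/step; case: (eqVneq p (lo l.2)) => [->|pl].
  exact: step_hi.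
case: (eqVneq p (hi l.2)) => [->|ph]; first exact: step_lo.
by rewrite /step (negPf pl) (negPf ph).
Qed.

Lemma step_bij l : bijective (step l).
Proof. by exists (step l); exact: stepK. Qed.

Lemma position_cons l w k : position (l :: w) k = position w (step l k).
Proof. by []. Qed.

Lemma position_rcons w l k : position (rcons w l) k = step l (position w k).
Proof. by rewrite /position foldl_rcons. Qed.

Lemma position_bij w : bijective (position w).
Proof.
elim: w => [|l w IH]; first by exists id.
exact: (bij_comp IH (step_bij l)).
Qed.

(* Sign of the crossing l if there the strand in position p passes over the one
   in position q, and 0 otherwise. *)
Definition over_sign l p q : int :=
  match l.1 with
  | Positive => if (p == lo l.2) && (q == hi l.2) then 1%R else 0%R
  | Negative => if (p == hi l.2) && (q == lo l.2) then (-1)%R else 0%R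
  | Virtual => 0%R
  end.

(** Strands are named by their initial positions: this is the signed number of crossings of [w] at
    which the strand starting in [k] passes over the one starting in [k']. *)
Fixpoint over_count w (k k' : 'I_n) : int :=
  if w is l :: w' then
    (over_sign l k k' + over_count w' (step l k) (step l k'))%R
  else 0%R.

Variables (G : groupType) (G2 : class2 G).

(** The index [q] is a position after the crossing, whence [step l q] in the exponent: the
    conjugator is a power of the meridian of the under strand as it leaves the crossing. *)
Lemma letter_action l (h : UMagmaMorphism.type (N n) G) k :
  h (phi (letter_eval l) (N_gen k)) =
  h (N_gen (step l k)) ^
    zprod (h \o @N_gen n) (fun q => - over_sign l k (step l q))%R.
Proof.
have stepE q q' : (step l q == q') = (q == step l q').
  exact: (can2_eq (stepK l) (stepK l)).
(* At most one exponent is non-zero: that of the position [p] where the under strand leaves, and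
   only if [k] is the over strand, which [b] records. *)
have zE z p (b : bool) : (forall q, over_sign l k (step l q) =
      if b && (q == p) then z else 0)%R ->
    zprod (h \o @N_gen n) (fun q => - over_sign l k (step l q))%R =
    if b then expz (h (N_gen p)) (- z)%R else 1.
  move=> e; rewrite -(zprod_delta (h \o @N_gen n)).
  case: b e => e; last first.
    by rewrite -(zprod0 (h \o @N_gen n)); apply: eq_bigr => q _; rewrite e oppr0.
  by apply: eq_bigr => q _; rewrite e /=; case: eqP => _; rewrite ?oppr0.
case: l stepE zE => -[] i stepE zE.
- rewrite (zE 1%R (lo i) (k == lo i)); last first.
    by move=> q; rewrite /over_sign /= stepE step_hi.
  rewrite -[letter_eval _]/(sigma i) phi_sigma; case: (eqVneq k (lo i)) => [->|kl].
    rewrite step_lo sigma_lo !gmulfM gmulfV expzN expz1 conjgE invgK.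
    by rewrite mulgA.
  case: (eqVneq k (hi i)) => [->|kh]; first by rewrite step_hi sigma_hi conjg1.
  by rewrite sigma_ne // conjg1 /step /= (negPf kl) (negPf kh).
- rewrite (zE (-1)%R (hi i) (k == hi i)); last first.
    by move=> q; rewrite /over_sign /= stepE step_lo.
  have -> : phi (letter_eval (Negative, i)) = (sigma_aut i)^-1.
    by rewrite -phi_sigma; exact: gmulfV.
  rewrite opprK expz1.
  have inv (x y : N n) : sigma_aut i y = x -> (sigma_aut i)^-1 x = y.
    by move=> <-; exact: aut_invK.
  case: (eqVneq k (lo i)) => [->|kl].
    by rewrite eq_sym hi_lo conjg1 step_lo (inv _ _ (sigma_hi i)).
  case: (eqVneq k (hi i)) => [->|kh].
    rewrite step_hi -gmulfJ; congr (h _); apply: inv.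
    by rewrite conjgE !autM autV sigma_hi sigma_lo mulgVK mulKg.
  by rewrite (inv _ _ (sigma_ne kl kh)) conjg1 /step /= (negPf kl) (negPf kh).
- rewrite (zE 0%R k false) // conjg1 -[letter_eval _]/(rho i) phi_rho.
  case: (eqVneq k (lo i)) => [->|kl]; first by rewrite step_lo rho_lo.
  case: (eqVneq k (hi i)) => [->|kh]; first by rewrite step_hi rho_hi.
  by rewrite rho_ne // /step /= (negPf kl) (negPf kh).
Qed.

Lemma braid_action w (h : UMagmaMorphism.type (N n) G) k :
  h (phi (braid_eval w) (N_gen k)) =
  h (N_gen (position w k)) ^
    zprod (h \o @N_gen n \o position w) (fun q => - over_count w k q)%R.
Proof.
elim: w k => [|l w IH] k.
  by rewrite /braid_eval big_nil gmulf1 zprod0 conjg1.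
rewrite /braid_eval big_cons phiM.
pose h' : UMagmaMorphism.type (N n) G := h \o phi (braid_eval w).
rewrite -[LHS]/(h' (phi (letter_eval l) (N_gen k))) letter_action.
rewrite -[h' (N_gen _)]/(h _) IH -conjgM position_cons.
set z := zprod (h' \o _) _.
(* The meridians in the conjugator of the first letter are transformed by the rest of the word, but
   only into conjugates of meridians, which induce the same inner automorphisms. *)
have hz : same_conj z (zprod (h \o @N_gen n \o position w)
    (fun q => - over_sign l k (step l q))%R).
  by apply: zprod_congr => q x; rewrite /= IH; exact: same_conjJ.
rewrite (same_conjM (fun=> erefl) hz) [RHS](zprod_reindex _ _ _ (step_bij l)) //.
rewrite -(zprodD G2); congr (_ ^ _); apply: eq_bigr => q _.
by rewrite /= -/(step _ _) !stepK opprD addrC.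
Qed.
End BraidAction.

(** * The group determined by a matrix of linking numbers *)

Section LinkingGroup.
Variables (K : finType).

Inductive linking_rel (a : K -> K -> int) :
    free_group K -> free_group K -> Prop :=
| linking_nil x y z : linking_rel a [~ x, [~ y, z]] 1
| linking_fix k : linking_rel a
    (free_gen k ^ zprod (@free_gen K) (a k)) (free_gen k).

(* The link group of a link with components K and linking numbers a: each
   meridian commutes with its longitude. *)
Definition linking_group (a : K -> K -> int) : groupType :=
  presented (linking_rel a).

Variable a : K -> K -> int.
Local Notation y := (@presented_gen _ (linking_rel a)).

Lemma linking_group_class2 : class2 (linking_group a).
Proof.
apply: presented_class2 => i k l.
have := presented_rel (linking_nil a (free_gen i) (free_gen k) (free_gen l)).
by rewrite !gmulfR gmulf1.
Qed.

Lemma linking_group_fix k : y k ^ zprod y (a k) = y k.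
Proof.
rewrite -[RHS](presented_rel (linking_fix a k)) gmulfJ gmulf_zprod.
by [].
Qed.

Lemma linking_group_hom (G : groupType) (x : K -> G) : class2 G ->
    (forall k, x k ^ zprod x (a k) = x k) ->
  exists h : UMagmaMorphism.type (linking_group a) G, forall k, h (y k) = x k.
Proof.
move=> G2 xa; apply: presented_lift_exists => _ _ [u v w|k].
  by rewrite !gmulfR gmulf1 G2.
rewrite gmulfJ gmulf_zprod /= free_lift_gen.
rewrite -[RHS]xa; congr (_ ^ _); apply: eq_bigr => l _.
by rewrite /= free_lift_gen.
Qed.
End LinkingGroup.

Lemma isomorphic_of_inverse (G H : groupType) (f : UMagmaMorphism.type G H)
    (g : UMagmaMorphism.type H G) :
  cancel f g -> cancel g f -> isomorphic G H.
Proof. by move=> fg gf; exists f; exists g. Qed.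

Lemma isomorphic_sym (G H : groupType) : isomorphic G H -> isomorphic H G.
Proof.
move=> [f [g fg gf]]; have gM := can2_gmulfM fg gf.
pose g' := HB.pack_for {multiplicative H -> G} g (isMultiplicative.Build H G g gM).
by exists g', f.
Qed.

Lemma isomorphic_trans (G H K : groupType) :
  isomorphic G H -> isomorphic H K -> isomorphic G K.
Proof.
move=> [f fb] [g gb].
pose h : {multiplicative G -> K} := g \o f.
by exists h; exact: bij_comp gb fb.
Qed.

(** Diagonal exponents may differ and the relabelled product may come in another order; neither
    changes the conjugate of the meridian concerned. *)
Lemma linking_group_relabel (K K' : finType) (a : K -> K -> int)
    (a' : K' -> K' -> int) (e : K -> K') : bijective e ->
    (forall i j, i != j -> a' (e i) (e j) = a i j) ->
  isomorphic (linking_group a) (linking_group a').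
Proof.
move=> eb ea; have [e' ee' e'e] := eb.
have H2 := @linking_group_class2 _ a; have H2' := @linking_group_class2 _ a'.
have e'b : bijective e' by exists e.
have [f fE] : exists f : UMagmaMorphism.type (linking_group a) (linking_group a'),
    forall k, f (presented_gen _ k) = presented_gen _ (e k).
  apply: linking_group_hom => // k; rewrite -[RHS]linking_group_fix.
  rewrite [RHS](zprod_reindex H2' _ _ eb).
  apply: (@conj_zprod_off _ H2' _ (fun k => presented_gen _ (e k))) => l lk.
  by rewrite /= ea // eq_sym.
have [g gE] : exists g : UMagmaMorphism.type (linking_group a') (linking_group a),
    forall k, g (presented_gen _ k) = presented_gen _ (e' k).
  apply: linking_group_hom => // k; rewrite -[RHS]linking_group_fix.
  rewrite [RHS](zprod_reindex H2 _ _ e'b).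
  apply: (@conj_zprod_off _ H2 _ (fun k => presented_gen _ (e' k))) => l lk.
  by rewrite /= -ea ?e'e // (can_eq e'e) eq_sym.
apply: (@isomorphic_of_inverse _ _ f g).
  by apply: (@presented_ext _ _ _ (g \o f) idfun) => k; rewrite /= fE gE ee'.
by apply: (@presented_ext _ _ _ (f \o g) idfun) => k; rewrite /= gE fE e'e.
Qed.

(** * Meridians along the components of a closed braid *)

Section Closure.
Variables (n : nat) (w : braid_word n) (K : finType).
Variables (c : 'I_n -> K) (m : 'I_n -> nat) (turns : K -> nat).

(* The strand k is the (m k)-th turn of the component c k. *)
Record closes_up : Prop := ClosesUp {
  turn_lt : forall k, m k < turns (c k);
  turn_unique : forall i j, j < turns i -> exists! k, c k = i /\ m k = j;
  turns_gt0 : forall i, 0 < turns i;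
  next_comp : forall k, c (position w k) = c k;
  next_turn : forall k, m (position w k) =
    if (m k).+1 == turns (c k) then 0 else (m k).+1
}.

Hypothesis cw : closes_up.

Definition comp_over (k : 'I_n) (j : K) : int :=
  (\sum_(l | c l == j) over_count w k l)%R.

Definition braid_linking (i j : K) : int :=
  (\sum_(k | c k == i) comp_over k j)%R.

(** Exponents of the initial piece of the longitude of the component [c k], from its first turn up
    to the strand [k] excluded. *)
Let before (k : 'I_n) (j : K) : int :=
  (\sum_(l | (c l == c k) && (m l < m k)%N) comp_over l j)%R.

Lemma turn_inj k l : c k = c l -> m k = m l -> k = l.
Proof.
move=> ckl mkl; have [k' [_ u]] := turn_unique cw (turn_lt cw k).
by rewrite -(u k) // (u l).
Qed.

Let before_succ k j : (\sum_(l | (c l == c k) && (m l <= m k)%N) comp_over l j =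
  before k j + comp_over k j)%R.
Proof.
rewrite (bigD1 k) /=; last by rewrite eqxx leqnn.
rewrite addrC; congr (_ + _)%R; apply: eq_bigl => l.
rewrite -andbA; case: eqP => //= ckl; rewrite ltn_neqAle andbC; congr (_ && _).
by congr (~~ _); apply/eqP/eqP => [->|/(turn_inj ckl)].
Qed.

Let before_next k : (m k).+1 != turns (c k) -> forall j,
  before (position w k) j = (before k j + comp_over k j)%R.
Proof.
move=> kT j; rewrite -before_succ /before (next_comp cw) (next_turn cw).
by rewrite (negPf kT).
Qed.

Let before_last k : (m k).+1 = turns (c k) -> forall j,
  braid_linking (c k) j = (before k j + comp_over k j)%R.
Proof.
move=> kT j; rewrite -before_succ; apply: eq_bigl => l.
case: eqP => //= ckl; rewrite -ltnS kT -ckl (turn_lt cw) //.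
Qed.

Let before0 k : m k = 0 -> before k = fun=> 0%R.
Proof.
by move=> k0; apply/funext => j; rewrite /before big_pred0 // => l; rewrite k0 andbF.
Qed.

Lemma first_strand i : exists k, c k = i /\ m k = 0.
Proof. by have [k [? _]] := turn_unique cw (turns_gt0 cw i); exists k. Qed.

Variables (u : 'I_n -> free_group 'I_n).
Hypothesis uw : represents (braid_eval w) u.

Local Notation x := (@presented_gen _ (link_group_rel u)).
Local Notation y := (@presented_gen _ (linking_rel braid_linking)).

Let G2 : class2 (fused_link_group u).
Proof.
apply: presented_class2 => i k l.
by have := presented_rel (link_nil u i k l); rewrite !gmulfR gmulf1.
Qed.

Let H2 := @linking_group_class2 _ braid_linking.

Lemma word_action (G : groupType) (g2 : class2 G) (f : 'I_n -> G) k :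
  free_lift f (u k) =
  f (position w k) ^ zprod (f \o position w) (fun q => - over_count w k q)%R.
Proof.
have [h hE] := N_hom_exists g2 f.
have hg i : h (N_gen i) = f i by rewrite hE free_lift_gen.
rewrite -hE uw braid_action // hg; congr (_ ^ _).
by apply: eq_bigr => q _; rewrite /= hg.
Qed.

(* The strands of a component have conjugate meridians, so inner automorphisms
   only see the component of each strand. *)
Lemma zprod_comp (G : groupType) (g2 : class2 G) (f : 'I_n -> G) (z : K -> G) k :
    (forall l, same_conj (f l) (z (c l))) ->
  same_conj (zprod (f \o position w) (fun q => - over_count w k q)%R)
    (zprod z (comp_over k))^-1.
Proof.
move=> fz; apply: same_conj_trans (zprodN g2 _ _).
apply: same_conj_trans (_ : same_conj _ (zprod (z \o c) _)) _.
  by apply: zprod_congr => q h; rewrite /= fz (next_comp cw).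
apply: same_conj_trans (zprod_fiber g2 _ _ _) _ => h.
congr (_ ^ _); apply: eq_bigr => j _; congr expz.
by rewrite /comp_over sumrN.
Qed.

(** The relation of the strand [k], solved for the meridian of the strand that continues it. *)
Lemma strand_conj (G : groupType) (g2 : class2 G) (f : 'I_n -> G) (z : K -> G) :
    (forall l, same_conj (f l) (z (c l))) ->
    (forall k, free_lift f (u k) = f k) ->
  forall k, f (position w k) = f k ^ zprod z (comp_over k).
Proof.
move=> fz fu k; rewrite -[f k]fu word_action // (zprod_comp _ _ fz) //.
by rewrite conjgKV.
Qed.

Lemma closure_linking_group :
  isomorphic (linking_group braid_linking) (fused_link_group u).
Proof.
pose first i := sval (cid (first_strand i)).
have firstP i : c (first i) = i /\ m (first i) = 0 := svalP (cid (first_strand i)).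
have firstE k : m k = 0 -> first (c k) = k.
  by move=> k0; have [cf mf] := firstP (c k); apply: turn_inj; rewrite ?mf.
have xu k : free_lift x (u k) = x k.
  by rewrite -quo_pi_free_lift (presented_rel (link_fix u k)).
pose z i := x (first i).
have xs k : exists g, x (position w k) = x k ^ g.
  pose g := zprod (x \o position w) (fun q => - over_count w k q)%R.
  by exists g^-1; rewrite -[x k]xu word_action // conjgK.
have pred k : m k != 0 -> exists k', [/\ position w k' = k, c k' = c k &
    m k = (m k').+1].
  have [v vK Kv] := position_bij w.
  move=> k0; exists (v k); split; first exact: Kv.
    by rewrite -(next_comp cw) Kv.
  by move: k0; rewrite -{1 2}(Kv k) (next_turn cw); case: ifP.
(* Induction along a component, starting from its first turn. *)
have turn_ind (P : 'I_n -> Prop) : (forall k, m k = 0 -> P k) ->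
    (forall k, (m k).+1 != turns (c k) -> P k -> P (position w k)) ->
    forall k, P k.
  move=> P0 PS k; move mk: (m k) => j; elim: j k mk => [|j IH] k mk.
    exact: P0.
  have [|k' [kE ck' mk']] := pred k; first by rewrite mk.
  rewrite -kE; apply: PS; last by apply: IH; move: mk; rewrite mk' => -[].
  by rewrite -mk' ck' neq_ltn (turn_lt cw).
(* Needed before [strand_conj], which presupposes that all meridians of a component induce the same
   inner automorphism. *)
have xz : forall k, same_conj (x k) (z (c k)).
  apply: turn_ind => [k k0 h|k _ IH]; first by rewrite /z firstE.
  rewrite (next_comp cw); apply: same_conj_trans IH.
  have [g ->] := xs k; exact: same_conjJ.
have xnext k := strand_conj G2 xz xu k.
(* The pieces of longitude met on the previous turns accumulate. *)
have xE : forall k, x k = z (c k) ^ zprod z (before k).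
  apply: turn_ind => [k k0|k kT IH].
    by rewrite before0 // zprod0 conjg1 /z firstE.
  rewrite xnext {1}IH -conjgM -(zprodD G2) (next_comp cw); congr (_ ^ _).
  by apply: eq_bigr => j _; rewrite before_next.
have last_strand i : exists k, c k = i /\ (m k).+1 = turns i.
  have lt : (turns i).-1 < turns i by rewrite prednK // (turns_gt0 cw).
  have [k [[ck mk] _]] := turn_unique cw lt.
  by exists k; rewrite mk prednK // (turns_gt0 cw).
have [f fE] : exists f : UMagmaMorphism.type (linking_group braid_linking)
    (fused_link_group u), forall i, f (y i) = z i.
  (* After the last turn comes the first strand again, so the accumulated conjugator is the whole
     longitude, and it fixes [z i]. *)
  apply: linking_group_hom => // i; have [k [ci kT]] := last_strand i.
  rewrite -ci in kT *.
  have -> : zprod z (braid_linking (c k)) =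
      zprod z (fun j => before k j + comp_over k j)%R.
    by apply: eq_bigr => j _; rewrite before_last.
  rewrite zprodD // conjgM -xE -xnext.
  by rewrite -(firstE (position w k)) ?(next_comp cw) // (next_turn cw) kT eqxx.
(* The inverse map must send [x k] to what [xE] dictates. *)
pose v k := y (c k) ^ zprod y (before k).
have vy l : same_conj (v l) (y (c l)) by exact: same_conjJ.
have vu k : free_lift v (u k) = v k.
  rewrite word_action // (zprod_comp _ _ vy) //.
  apply: (conjg_inj (zprod y (comp_over k))); rewrite conjgKV /v -conjgM.
  (* On the last turn the relation is that of the linking group; on the others it holds by
     construction of [before]. *)
  rewrite -(zprodD H2) (next_comp cw); case: (eqVneq (m k).+1 (turns (c k))) => kT.
    rewrite before0 ?zprod0 ?conjg1; last by rewrite (next_turn cw) kT eqxx.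
    rewrite -[LHS]linking_group_fix; congr (_ ^ _); apply: eq_bigr => j _.
    by rewrite before_last.
  by congr (_ ^ _); apply: eq_bigr => j _; rewrite before_next.
have [g gE] : exists g : UMagmaMorphism.type (fused_link_group u)
    (linking_group braid_linking), forall k, g (x k) = v k.
  apply: presented_lift_exists => _ _ [i|i k l].
    by rewrite vu free_lift_gen.
  by rewrite !gmulfR gmulf1 H2.
apply: (@isomorphic_of_inverse _ _ f g).
  apply: (@presented_ext _ _ _ (g \o f) idfun) => i; have [cf mf] := firstP i.
  by rewrite /= fE /z gE /v cf before0 // zprod0 conjg1.
apply: (@presented_ext _ _ _ (f \o g) idfun) => k.
rewrite /= gE /v gmulfJ gmulf_zprod fE [RHS]xE; congr (_ ^ _).
by apply: eq_bigr => j _; rewrite /= fE.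
Qed.
End Closure.
Local Close Scope group_scope.
Local Open Scope ring_scope.

(** * Linking numbers and their invariance under the moves *)

Section DiagramPoints.
Variables (R : realType) (D : diagram R).
Local Notation point := ('I_(ncomp D) * R)%type.
Implicit Types (p q r : point) (i j : 'I_(ncomp D)) (x : R * R).

Lemma same_point_refl p : same_point p p.
Proof. by split=> //; exists 0; rewrite addr0. Qed.

Lemma same_point_sym p q : same_point p q -> same_point q p.
Proof.
by move=> [e [z ez]]; split=> //; exists (- z); rewrite ez rmorphN addrK.
Qed.

Lemma same_point_trans p q r :
  same_point p q -> same_point q r -> same_point p r.
Proof.
move=> [e [z ez]] [e' [z' ez']]; split; first by rewrite e.
by exists (z + z'); rewrite ez' ez rmorphD addrA.
Qed.

Lemma curve_periodicz i t (z : int) : curve D i (t + z%:~R) = curve D i t.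
Proof.
have nat_case (k : nat) s : curve D i (s + k%:R) = curve D i s.
  elim: k => [|k IH]; first by rewrite addr0.
  by rewrite -natr1 addrA curve_periodic.
case: z => k; first exact: nat_case.
by rewrite NegzE rmorphN /= -(nat_case k.+1 (t - _)) -pmulrn subrK.
Qed.

Lemma at_point_same p q :
  same_point p q -> at_point (curve D) q = at_point (curve D) p.
Proof.
by case: p q => [i s] [j t] [/= <- [z ->]]; exact: curve_periodicz.
Qed.

Lemma velocity_same p q :
  same_point p q -> velocity (curve D) q = velocity (curve D) p.
Proof.
case: p q => [i s] [j t] [/= <- [z ->]].
rewrite /velocity /= /derive1.
suff -> : (fun h : R => h^-1 *: (curve D i (h + (s + z%:~R)) -
    curve D i (s + z%:~R))) =
  (fun h : R => h^-1 *: (curve D i (h + s) - curve D i s)) by [].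
by apply/funext => h; rewrite addrA !curve_periodicz.
Qed.

Lemma meet_sym p q : meet (curve D) p q -> meet (curve D) q p.
Proof. by move=> [pq e]; split=> // /same_point_sym. Qed.

Lemma meet_same p q p' q' : same_point p p' -> same_point q q' ->
  meet (curve D) p q -> meet (curve D) p' q'.
Proof.
move=> pp qq [pq e]; split; last by rewrite (at_point_same pp) (at_point_same qq).
move=> pq'; apply: pq; apply: same_point_trans pp _.
exact: same_point_trans pq' (same_point_sym qq).
Qed.

Lemma over_same p q p' q' : same_point p p' -> same_point q q' ->
  over p q -> over p' q'.
Proof.
move=> pp qq [pq h]; split; first exact: meet_same pq.
by rewrite (at_point_same pp) (velocity_same pp) (velocity_same qq).
Qed.

Lemma det2C (v w : R * R) : det2 v w = - det2 w v.
Proof. by rewrite /det2 opprB [v.2 * _]mulrC [v.1 * _]mulrC. Qed.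

(** The determinant changes sign when the strands are exchanged, whereas the mark belongs to their
    common image. *)
Lemma over_asym p q : over p q -> ~ over q p.
Proof.
have gt0C (v w : R * R) : 0 < det2 v w -> 0 < det2 w v -> False.
  by rewrite det2C oppr_gt0 => /ltW /le_gtF ->.
have lt0C (v w : R * R) : det2 v w < 0 -> det2 w v < 0 -> False.
  by rewrite det2C oppr_lt0 => /ltW /le_gtF ->.
move=> [[_ e] h] [_ h']; move: h h'; rewrite e; case: (mark _ _) => // h h'.
  exact: gt0C h h'.
exact: lt0C h h'.
Qed.

Lemma meet_cases p q r : meet (curve D) p q ->
  at_point (curve D) r = at_point (curve D) p -> same_point r p \/ same_point r q.
Proof.
move=> pq rp; have [?|rp'] := EM (same_point r p); [by left|right].
apply/same_point_sym; apply: (curve_double (meet_sym (meet_sym pq)) _).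
by split=> // /same_point_sym.
Qed.

(** The test made inside [over], isolated for rewriting; [overE] holds by conversion. *)
Definition sign_agrees (c : crossing) (d : R) : Prop :=
  match c with Positive => 0 < d | Negative => d < 0 | Virtual => False end.

Lemma sign_agrees_congr c c' (v v' w w' : R * R) :
  c = c' -> v = v' -> w = w' ->
  sign_agrees c (det2 v w) = sign_agrees c' (det2 v' w').
Proof. by move=> -> -> ->. Qed.

Lemma overE p q : over p q = (meet (curve D) p q /\
  sign_agrees (mark D (at_point (curve D) p))
    (det2 (velocity (curve D) p) (velocity (curve D) q))).
Proof. by []. Qed.

Lemma over_meet p q : over p q -> meet (curve D) p q.
Proof. by case. Qed.

(** Points of the plane rather than pairs of parameters: the latter are defined only modulo 1 and
    would count each crossing infinitely often. *)
Definition crossings_over i j : set (R * R) :=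
  [set x | exists s t, over (i, s) (j, t) /\ x = curve D i s].

Definition crossing_sign (c : crossing) : int :=
  match c with Positive => 1 | Negative => -1 | Virtual => 0 end.

(* Meaningful only for i != j. *)
Definition linking_number i j : int :=
  \sum_(x \in crossings_over i j) crossing_sign (mark D x).

Lemma finite_crossings_over i j : finite_set (crossings_over i j).
Proof.
apply: sub_finite_set (curve_finite D) => _ [s [t [[st _] ->]]].
by exists (i, s) => //; exists (j, t).
Qed.

Lemma curve_continuous i : continuous (curve D i).
Proof.
move=> t; apply: differentiable_continuous; apply/derivable1_diffP.
exact: (@curve_smooth R D i 0%N t).
Qed.

Section Arcs.
Variables (r : nat) (c : 'I_r -> 'I_(ncomp D)) (a b : 'I_r -> R).
Variable (B : set (R * R)).
Hypothesis arcs : disk_arcs c a b B.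

Lemma arcs_meet_sym k s l t : arcs_meet c a b k s l t -> arcs_meet c a b l t k s.
Proof. by move=> [ks lt m]; split=> //; exact: meet_sym. Qed.

Lemma arcs_inj k l s t : a k < s < b k -> a l < t < b l ->
  same_point (c k, s) (c l, t) -> k = l.
Proof.
have [_ inj _ _ _] := arcs => /andP[? ?] /andP[? ?] st.
by apply: inj st; rewrite !ltW.
Qed.

(** Integer translations bring the parameters of a crossing in [B] into the arcs, and no crossing
    lies on the boundary of [B], so they fall in the open intervals. *)
Lemma crossings_over_disk i j : crossings_over i j `&` B = [set x |
  exists k s l t, [/\ c k = i, c l = j, arcs_meet c a b k s l t,
    arcs_over c k s l t & x = curve D (c k) s]].
Proof.
have [_ _ inB intB crossB] := arcs.
apply/seteqP; split=> [_ [[s [t [st ->]]] Bs]|x]; last first.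
  move=> [k [s [l [t [<- <- [ks lt m] o ->]]]]]; split; first by exists s, t.
  have /andP[? ?] := ks.
  by apply: (inB (c k, s)).2; exists k, s; split; [rewrite !ltW|exact: same_point_refl].
have [m _] := st; have Bt : B (at_point (curve D) (j, t)) by rewrite -m.2.
have [k [s' [ks' ss']]] := (inB (i, s)).1 Bs.
have [l [t' [lt' tt']]] := (inB (j, t)).1 Bt.
have m' := meet_same ss' tt' m; have o' := over_same ss' tt' st.
exists k, s', l, t'; split=> //; first by case: ss'.
- by case: tt'.
- have iB : B° (at_point (curve D) (c k, s')).
    by apply: crossB m' _; rewrite (at_point_same ss').
  split=> //; first exact/(intB _ _ ks').
  by apply/(intB _ _ lt'); rewrite -[curve D _ _]/(at_point (curve D) (c l, t')) -m'.2.
- exact: esym (at_point_same ss').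
Qed.

(** As [i != j], the components tell the two strands of a crossing apart, and the arcs are disjoint
    in the 1-manifold; hence a crossing point determines its ordered pair of arcs. *)
Lemma crossings_over_disk_pairs i j (s : 'I_r -> 'I_r -> R) : i != j ->
    (forall k u l v, arcs_meet c a b k u l v <->
      [/\ k != l, u = s k l & v = s l k]) ->
  \sum_(x \in crossings_over i j `&` B) crossing_sign (mark D x) =
  \sum_(kl \in [set kl : 'I_r * 'I_r | [/\ kl.1 != kl.2, c kl.1 = i, c kl.2 = j &
      arcs_over c kl.1 (s kl.1 kl.2) kl.2 (s kl.2 kl.1)]])
    crossing_sign (arc_mark c kl.1 (s kl.1 kl.2)).
Proof.
move=> ij sP; rewrite crossings_over_disk.
apply: (reindex_fsbig (fun kl : 'I_r * 'I_r => curve D (c kl.1) (s kl.1 kl.2))).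
split.
- move=> [k l] /= [kl ki lj o]; exists k, (s k l), l, (s l k); split=> //.
  exact/sP.
- move=> [k l] [k' l'] /set_mem [/= kl ki lj o] /set_mem [/= kl' ki' lj' o'] e.
  have /sP m : [/\ k != l, s k l = s k l & s l k = s l k] by [].
  have /sP m' : [/\ k' != l', s k' l' = s k' l' & s l' k' = s l' k'] by [].
  have [[? ? mm] [? ? mm']] := (m, m').
  have [/arcs_inj kk|[/= /eqP]] := @meet_cases _ _ (c k', s k' l') mm (esym e);
    last first.
    by rewrite ki' lj (negPf ij).
  have e' : at_point (curve D) (c l', s l' k') = at_point (curve D) (c l, s l k).
    by rewrite -(proj2 mm') -(proj2 mm); exact: esym.
  have [/arcs_inj ll|[/= /eqP]] := meet_cases (meet_sym mm) e'; last first.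
    by rewrite ki lj' eq_sym (negPf ij).
  by rewrite kk // ll.
- move=> x [k [u [l [v [ki lj m o xE]]]]]; have /sP[kl uE vE] := m.
  by exists (k, l); rewrite /= -?uE -?vE.
Qed.
End Arcs.
End DiagramPoints.

Arguments crossings_over {R} D i j _.
Arguments linking_number {R} D i j.

Lemma same_point_rescale (R : realType) k k' (f : 'I_k -> 'I_k') (p q : 'I_k * R) :
  same_point p q -> same_point (f p.1, p.2) (f q.1, q.2).
Proof. by move=> [e [z ez]]; split; [rewrite /= e|exists z]. Qed.

(** Makes the complement of [B] open, so that two diagrams agreeing outside [B] have the same
    velocities there. *)
Lemma disk_closed (R : realType) (B : set (R * R)) : closed_disk B -> closed B.
Proof.
move=> [f [[fc [g [gc fg gf]]] ->]].
have -> : f @` [set p | p.1 ^+ 2 + p.2 ^+ 2 <= 1] =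
    (fun p => (g p).1 ^+ 2 + (g p).2 ^+ 2) @^-1` [set t | t <= 1].
  apply/seteqP; split=> [_ [p pd <-]|p pd]; rewrite /= ?fg //.
  by exists (g p).
apply: (@preimage_closed _ R^o _ [set t | t <= 1]); last exact: closed_le.
move=> p _.
have c1 : (g q).1 @[q --> p] --> (g p).1.
  by apply: (cvg_comp _ _ (gc p)); exact: cvg_fst.
have c2 : (g q).2 @[q --> p] --> (g p).2.
  by apply: (cvg_comp _ _ (gc p)); exact: cvg_snd.
exact: cvgD (cvgM c1 c1) (cvgM c2 c2).
Qed.

(** * Two diagrams that agree outside a disk *)

Section OutsideDisk.
Variables (R : realType) (D D' : diagram R) (B : set (R * R)).
Variables (e : 'I_(ncomp D) -> 'I_(ncomp D')) (r : nat).
Variables (c : 'I_r -> 'I_(ncomp D)) (a b : 'I_r -> R).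
Hypothesis so : same_outside B e c a b.

Let eb : bijective e. Proof. by have [] := so. Qed.

Lemma same_point_relabel (p q : 'I_(ncomp D) * R) :
  same_point (e p.1, p.2) (e q.1, q.2) <-> same_point p q.
Proof.
split=> [[/= /(bij_inj eb) ? [z ?]]|]; first by split=> //; exists z.
exact: same_point_rescale.
Qed.

(** The same parameter intervals describe the preimage of [B] for both diagrams. *)
Lemma disk_relabel i t : B (curve D' (e i) t) <-> B (curve D i t).
Proof.
have [_ _ [[_ _ inB _ _] [_ _ inB' _ _]] _ _] := so.
split=> [/(inB' (e i, t))|/(inB (i, t))] [k [u [ku sp]]].
  by apply/(inB (i, t)); exists k, u; split=> //; exact/same_point_relabel.
apply/(inB' (e i, t)); exists k, u; split=> //.
exact: (@same_point_rescale _ _ _ e _ _ sp).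
Qed.

Lemma curve_outside i t : ~ B (curve D i t) -> curve D' (e i) t = curve D i t.
Proof.
by have [_ _ _ h _] := so; move=> nB; apply: h => /interior_subset.
Qed.

Lemma velocity_outside i t : ~ B (curve D i t) ->
  velocity (curve D') (e i, t) = velocity (curve D) (i, t).
Proof.
move=> nB; rewrite /velocity /= !derive1E; apply: near_eq_derive.
have Bo : open (~` B) by apply: closed_openC; apply: disk_closed; have [] := so.
have nBt : \forall s \near t, ~ B (curve D i s).
  exact: (@curve_continuous _ D i t (~` B) (open_nbhs_nbhs (conj Bo nB))).
by apply: filterS nBt => s; exact: curve_outside.
Qed.

Lemma meet_outside i s j t : ~ B (curve D i s) ->
  meet (curve D') (e i, s) (e j, t) <-> meet (curve D) (i, s) (j, t).
Proof.
move=> nB; rewrite /meet.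
have -> : same_point (e i, s) (e j, t) = same_point (i, s) (j, t).
  by apply/propext; exact: (same_point_relabel (i, s) (j, t)).
rewrite /at_point /= curve_outside //.
split=> -[ns eq]; split=> //.
  by rewrite -(@curve_outside j) // -disk_relabel -eq.
by rewrite (@curve_outside j) // -eq.
Qed.

Lemma over_outside i s j t : ~ B (curve D i s) ->
  over (D := D') (e i, s) (e j, t) <-> over (D := D) (i, s) (j, t).
Proof.
move=> nB; rewrite !overE (propext (meet_outside j t nB)).
suff E : meet (curve D) (i, s) (j, t) ->
    sign_agrees (mark D' (at_point (curve D') (e i, s)))
      (det2 (velocity (curve D') (e i, s)) (velocity (curve D') (e j, t))) =
    sign_agrees (mark D (at_point (curve D) (i, s)))
      (det2 (velocity (curve D) (i, s)) (velocity (curve D) (j, t))).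
  split=> -[m h]; (split; first exact: m).
    by rewrite -(E m); exact: h.
  by rewrite (E m); exact: h.
move=> m; apply: sign_agrees_congr.
- rewrite /at_point /= curve_outside //.
  by have [_ _ _ _ h] := so; exact: h m nB.
- exact: velocity_outside.
- by apply: velocity_outside; rewrite -[curve D j t]m.2.
Qed.

(** The crossings outside [B] and their marks are common to both diagrams, so only the sums over [B]
    have to be compared. *)
Lemma linking_number_outside i j :
    \sum_(x \in crossings_over D' (e i) (e j) `&` B) crossing_sign (mark D' x) =
    \sum_(x \in crossings_over D i j `&` B) crossing_sign (mark D x) ->
  linking_number D' (e i) (e j) = linking_number D i j.
Proof.
move=> EB; rewrite /linking_number.
rewrite (fsbigID B) /=; last exact: finite_crossings_over.
rewrite [RHS](fsbigID B) /=; last exact: finite_crossings_over.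
rewrite EB; congr (_ + _).
have -> : crossings_over D' (e i) (e j) `&` ~` B = crossings_over D i j `&` ~` B.
  apply/seteqP; split=> _ [[s [t [st ->]]] nB].
    have nB' : ~ B (curve D i s) by rewrite -disk_relabel.
    rewrite (curve_outside nB'); split; last exact: nB'.
    by exists s, t; split; [exact: (over_outside j t nB').1 st|].
  split; last exact: nB.
  exists s, t; split; last exact: (esym (curve_outside nB)).
  exact: (over_outside j t nB).2 st.
apply: eq_fsbigr => x; rewrite inE => -[[s [t [/over_meet m ->]]] nB].
congr crossing_sign; have [_ _ _ _ h] := so; exact: h m nB.
Qed.
End OutsideDisk.

(** * Linking numbers up to relabelling of the components *)

Section LinkedAlike.
Variable R : realType.
Implicit Types D : diagram R.

(** An equivalence relation, so it suffices to check the generating moves. The diagonal is left out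
    because type I moves may change it. *)
Definition linked_alike D D' := exists e : 'I_(ncomp D) -> 'I_(ncomp D'),
  bijective e /\
  forall i j, i != j -> linking_number D' (e i) (e j) = linking_number D i j.

Lemma linked_alike_refl D : linked_alike D D.
Proof. by exists id; split=> //; exists id. Qed.

Lemma linked_alike_sym D D' : linked_alike D D' -> linked_alike D' D.
Proof.
move=> [e [[e' ee' e'e] h]]; exists e'; split; first by exists e.
by move=> i j ij; rewrite -h ?e'e // (can_eq e'e).
Qed.

Lemma linked_alike_trans D D' D'' :
  linked_alike D D' -> linked_alike D' D'' -> linked_alike D D''.
Proof.
move=> [e [eb h]] [f [fb k]]; exists (f \o e); split; first exact: bij_comp.
by move=> i j ij; rewrite /= k ?h // (bij_eq eb).
Qed.
End LinkedAlike.

Section Translations.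
Variables (R : realType) (tau : R -> R).
Hypotheses (tauc : continuous tau) (tau1 : forall t, tau (t + 1) = tau t + 1).

Lemma translate_natr t k : tau (t + k%:R) = tau t + k%:R.
Proof.
elim: k => [|k IH]; first by rewrite !addr0.
by rewrite -natr1 !addrA tau1 IH.
Qed.

Lemma translate_intr t (z : int) : tau (t + z%:~R) = tau t + z%:~R.
Proof.
case: z => k; first exact: translate_natr.
rewrite NegzE rmorphN /= -pmulrn; apply: (addIr k.+1%:R).
by rewrite -translate_natr !subrK.
Qed.

(** Between [-k] and [k], with [k] larger than the distance from [y] to [tau 0], [tau] goes from
    [tau 0 - k] to [tau 0 + k] and so takes the value [y]. *)
Lemma translate_surj y : exists t, tau t = y.
Proof.
pose k := Num.bound `|y - tau 0|.
have kP : `|y - tau 0| < k%:R by exact: archi_boundP (normr_ge0 _).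
have [|||t _ <-] := @IVT R tau (- k%:R) k%:R y; last by exists t.
- by have := ler0n R k; lra.
- by apply: continuous_subspaceT => t; exact: tauc.
have E1 : tau k%:R = tau 0 + k%:R by rewrite -translate_natr add0r.
have E2 : tau (- k%:R) = tau 0 - k%:R.
  by apply: (addIr k%:R); rewrite -translate_natr addNr subrK.
move: kP; rewrite E1 E2 ltr_norml ge_min le_max => /andP[? ?].
by apply/andP; split; apply/orP; [left|right]; lra.
Qed.
End Translations.

(** The map [H 1] carries the crossings of [i] over [j] bijectively onto those of [e i] over [e j],
    with the same marks. *)
Lemma isotopic_linked (R : realType) (D D' : diagram R) :
  isotopic D D' -> linked_alike D D'.
Proof.
move=> [H [e [tau [[_ _ H1] eb tauP cE mE]]]]; exists e; split=> // i j ij.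
have {}H1 : injective (H 1).
  by have [|_ [g [_ HK _]]] := H1 1; [rewrite ler01 lexx|exact: can_inj HK].
have tauc k : continuous (tau k) by have [] := tauP k.
have tau1 k t : tau k (t + 1) = tau k t + 1 by have [] := tauP k.
have sameE p q : same_point p q ->
    same_point (e p.1, tau p.1 p.2) (e q.1, tau q.1 q.2).
  move=> [pq [z qz]]; split; first by rewrite /= pq.
  by exists z; rewrite /= qz -pq; exact: translate_intr.
rewrite /linking_number (reindex_fsbig (H 1) (crossings_over D i j)); last first.
  split.
  - move=> x [s [t [st ->]]]; exists (tau i s), (tau j t); split; last exact: esym.
    exact: ((mE _ _ (over_meet st)).2.1 st).
  - by move=> x y _ _; exact: H1.
  (* A crossing of [D'] comes from [D]: its parameters lift through [tau], and the lifted points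
     coincide because [H 1] is injective. *)
  - move=> x [s' [t' [st' ->]]].
    have [s sE] := translate_surj (tauc i) (tau1 i) s'.
    have [t tE] := translate_surj (tauc j) (tau1 j) t'.
    have m : meet (curve D) (i, s) (j, t).
      have [ns eq] := over_meet st'; split.
        by move=> /sameE /=; rewrite sE tE.
      apply: H1; rewrite -[at_point _ _]/(curve D i s) -cE sE.
      by rewrite -[at_point _ (j, t)]/(curve D j t) -cE tE.
    exists (curve D i s); last by rewrite -cE sE.
    exists s, t; split; last by [].
    by apply: (mE _ _ m).2.2; rewrite /= sE tE; exact: st'.
apply: eq_fsbigr => x; rewrite inE => -[s [t [/over_meet m ->]]].
by congr crossing_sign; have [<- _] := mE _ _ m.
Qed.

(** * Invariance under the Reidemeister moves *)

Section Moves.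
Variables (R : realType) (D D' : diagram R).

Lemma outside_alike B e r (c : 'I_r -> 'I_(ncomp D)) a b :
    same_outside (D' := D') B e c a b ->
    (forall i j, i != j ->
      \sum_(x \in crossings_over D' (e i) (e j) `&` B) crossing_sign (mark D' x) =
      \sum_(x \in crossings_over D i j `&` B) crossing_sign (mark D x)) ->
  linked_alike D D'.
Proof.
move=> so h; exists e; split; first by have [] := so.
by move=> i j ij; apply: (linking_number_outside so); exact: h.
Qed.

Lemma disk_no_crossing (D0 : diagram R) B r (c : 'I_r -> 'I_(ncomp D0)) a b i j :
    disk_arcs c a b B ->
    (forall k l, c k = i -> c l = j -> forall u v, ~ arcs_meet c a b k u l v) ->
  \sum_(x \in crossings_over D0 i j `&` B) crossing_sign (mark D0 x) = 0.
Proof.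
move=> arcs h; rewrite (crossings_over_disk arcs).
apply: fsbig1 => x [k [s [l [t [ki lj m _ _]]]]].
by case: (h k l ki lj s t m).
Qed.

(** The disk contains a single arc, hence only crossings of a component with itself. *)
Lemma reidemeister1_linked : reidemeister1 D D' -> linked_alike D D'.
Proof.
move=> [B [e [c [a [b [so _ _]]]]]]; apply: (outside_alike so) => i j ij.
have [_ eb [arcs arcs'] _ _] := so.
rewrite (disk_no_crossing arcs) ?(disk_no_crossing arcs') //.
- move=> k l kc lc; case/eqP: ij; apply: (bij_inj eb).
  by rewrite -kc -lc !ord1.
- by move=> k l kc lc; case/eqP: ij; rewrite -kc -lc !ord1.
Qed.

(** Ordered pairs of arcs index the crossings both before and after the move, with the same over
    strand and the same mark. *)
Lemma reidemeister3_linked : reidemeister3 D D' -> linked_alike D D'.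
Proof.
move=> [B [e [c [a [b [so [s [s' [sP s'P _ sE _]]]]]]]]].
apply: (outside_alike so) => i j ij; have [_ eb [arcs arcs'] _ _] := so.
rewrite (crossings_over_disk_pairs arcs ij sP).
rewrite (crossings_over_disk_pairs arcs' _ s'P) ?(bij_eq eb) //.
apply: etrans; [apply: eq_fsbigl|apply: eq_fsbigr].
  apply/seteqP; split=> -[k l].
    move=> [/= kl /(bij_inj eb) ki /(bij_inj eb) lj st].
    split; [exact: kl|exact: ki|exact: lj|exact: ((sE k l kl).2.1 st)].
  move=> [/= kl ki lj st].
  split; [exact: kl|exact: congr1 ki|exact: congr1 lj|exact: ((sE k l kl).2.2 st)].
move=> -[k l]; rewrite inE => -[/= kl _ _ _].
by rewrite (sE k l kl).1.
Qed.

Lemma over_not_virtual (D0 : diagram R) (p q : 'I_(ncomp D0) * R) :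
  over p q -> mark D0 (at_point (curve D0) p) <> Virtual.
Proof. by rewrite overE => -[_]; case: (mark _ _). Qed.

Lemma reidemeister2_linked : reidemeister2 D D' -> linked_alike D D'.
Proof.
move=> [B [e [c [a [b [so noX [s [t [st noself X' kinds]]]]]]]]].
apply: (outside_alike so) => i j ij; have [_ eb [arcs arcs'] _ _] := so.
rewrite [RHS](disk_no_crossing arcs) //.
set c' := e \o c in arcs' noself X' kinds.
have ord2 (k : 'I_2) : k = ord0 \/ k = ord_max.
  by case: k => -[|[|//]] ?; [left|right]; exact: val_inj.
(* If [e i] nowhere passes over [e j] in the disk, both sums are empty. *)
have [kl|] := EM (exists k l u v,
    [/\ c' k = e i, c' l = e j, arcs_meet c' a b k u l v & arcs_over c' k u l v]);
    last first.
  move=> no; rewrite (crossings_over_disk arcs'); apply: fsbig1 => x.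
  move=> [k [u [l [v [ki lj m o _]]]]]; case: no; exists k, l, u, v.
  by split; [exact: ki|exact: lj|exact: m|exact: o].
have {}X' k l : k != l -> forall u v, arcs_meet c' a b k u l v <->
    (u = s k /\ v = s l) \/ (u = t k /\ v = t l).
  have [->|->] := ord2 k; have [->|->] := ord2 l => // _ u v.
  split=> [/arcs_meet_sym /X'|h]; first by move=> [[-> ->]|[-> ->]]; tauto.
  by apply/arcs_meet_sym/X'; case: h => -[-> ->]; tauto.
have [k [l [u [v [ki lj m o]]]]] := kl.
have kNl : k != l.
  by apply: contraTneq ij => kl'; rewrite negbK -(bij_eq eb) -ki -lj kl'.
(* A crossing is one point of the plane, so its mark can be read along either arc. *)
have mark_s h : arc_mark c' h (s h) = arc_mark c' ord0 (s ord0).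
  have [->|->] := ord2 h; first by [].
  have [_ _ [_ eq]] := (X' ord0 ord_max isT (s ord0) (s ord_max)).2
    (or_introl (conj erefl erefl)).
  exact: congr1 (esym eq).
have mark_t h : arc_mark c' h (t h) = arc_mark c' ord0 (t ord0).
  have [->|->] := ord2 h; first by [].
  have [_ _ [_ eq]] := (X' ord0 ord_max isT (t ord0) (t ord_max)).2
    (or_intror (conj erefl erefl)).
  exact: congr1 (esym eq).
have lE h : (h != k) = (h == l).
  by move: kNl; have [->|->] := ord2 k; have [->|->] := ord2 l;
    have [->|->] := ord2 h.
(* The crossing [o] excludes the virtual case. In the classical case one arc is over at both
   crossings, and [o] forces it to be [k]. *)
have [over_s over_t marks] : [/\ arcs_over c' k (s k) l (s l),
    arcs_over c' k (t k) l (t l) &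
    arc_mark c' k (s k) = Positive /\ arc_mark c' k (t k) = Negative \/
    arc_mark c' k (s k) = Negative /\ arc_mark c' k (t k) = Positive].
  rewrite mark_s mark_t; case: kinds => [[vs vt]|[marks overs]].
    case: (over_not_virtual o); have [[uE _]|[uE _]] := (X' k l kNl u v).1 m.
      by rewrite uE -vs; exact: mark_s.
    by rewrite uE -vt; exact: mark_t.
  suff [os ot] : arcs_over c' k (s k) l (s l) /\ arcs_over c' k (t k) l (t l).
    by split; [exact: os|exact: ot|exact: marks].
  have no : arcs_over c' l (s l) k (s k) -> arcs_over c' l (t l) k (t k) ->
      arcs_over c' k (s k) l (s l) /\ arcs_over c' k (t k) l (t l).
    move=> os ot; have [[uE vE]|[uE vE]] := (X' k l kNl u v).1 m.
      by rewrite uE vE in o; case: (over_asym o os).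
    by rewrite uE vE in o; case: (over_asym o ot).
  case: (ord2 k) => kE; case: (ord2 l) => lE'; rewrite kE lE' in kNl no *.
  - by [].
  - by case: overs => -[os ot]; [split; [exact: os|exact: ot]|exact: no os ot].
  - by case: overs => -[os ot]; [exact: no os ot|split; [exact: os|exact: ot]].
  - by [].
(* The sum runs over two points of opposite signs, which are distinct because their marks differ. *)
rewrite (_ : crossings_over D' (e i) (e j) `&` B =
  [set curve D' (c' k) (s k)] `|` [set curve D' (c' k) (t k)]).
  rewrite fsbigU0; try exact: finite_set1.
    rewrite !fsbig_set1 /=.
    by case: marks; rewrite /arc_mark => -[-> ->].
  move=> x [-> xE]; case: marks; rewrite /arc_mark xE.
    by move=> [-> ].
  by move=> [-> ].
rewrite (crossings_over_disk arcs'); apply/seteqP; split.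
  move=> x [k1 [u1 [l1 [v1 [k1i l1j m1 _ ->]]]]].
  have k1E : k1 = k.
    apply/eqP; apply: contraT; rewrite lE => /eqP k1l.
    by case/eqP: ij; apply: (bij_inj eb); rewrite -k1i k1l.
  have l1E : l1 = l.
    apply/eqP; rewrite -lE; apply: contraTneq ij => l1k.
    by rewrite negbK -(bij_eq eb) -l1j l1k ki.
  rewrite k1E l1E in m1 *; have [[-> _]|[-> _]] := (X' k l kNl u1 v1).1 m1.
    by left.
  by right.
move=> x [] ->.
  exists k, (s k), l, (s l); split; [exact: ki|exact: lj| |exact: over_s|by []].
  by apply/X'; [exact: kNl|left].
exists k, (t k), l, (t l); split; [exact: ki|exact: lj| |exact: over_t|by []].
by apply/X'; [exact: kNl|right].
Qed.
End Moves.

Lemma fused_isotopic_linked (R : realType) (D D' : diagram R) :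
  fused_isotopic D D' -> linked_alike D D'.
Proof.
elim=> {D D'} [D D' []|D|D D' _ IH|D D' D'' _ IH _ IH'].
- exact: isotopic_linked.
- exact: reidemeister1_linked.
- exact: reidemeister2_linked.
- exact: reidemeister3_linked.
- exact: linked_alike_refl.
- exact: linked_alike_sym.
- exact: linked_alike_trans IH IH'.
Qed.
(** * Linking numbers of closures *)

(** The map [f \o g'] is strictly increasing, and the only such self-map of ['I_n] is the
    identity. *)
Lemma ord_increasing_eq n (f g : 'I_n -> 'I_n) : bijective g ->
  (forall k l, (f k < f l)%N = (g k < g l)%N) -> f =1 g.
Proof.
move=> [g' gg' g'g] fg; pose h := f \o g'.
have hlt k l : (h k < h l)%N = (k < l)%N by rewrite fg !g'g.
have hinj : injective h.
  move=> k l /(congr1 (@nat_of_ord n)) hkl; apply/val_inj.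
  by case: (ltngtP k l) => //; rewrite -hlt hkl ltnn.
have hsurj k : exists p, h p = k by have [q _ qK] := injF_bij hinj; exists (q k).
suff hid j (k : 'I_n) : k = j :> nat -> h k = k.
  by move=> k; rewrite -(hid _ (g k) erefl) /h /= gg'.
elim/ltn_ind: j k => j IH k kj; have [p hp] := hsurj k.
have fixlt (l : 'I_n) : (l < k)%N -> h l = l by rewrite kj => lj; exact: IH lj l erefl.
case: (ltngtP (h k) k) => [hk|hk|/val_inj //].
  by apply/hinj/fixlt.
case: (ltngtP p k) => [pk|pk|/val_inj pk].
- by have := fixlt _ pk; rewrite hp => kp; move: pk; rewrite kp ltnn.
- by move: pk; rewrite -hlt hp => /(ltn_trans hk); rewrite ltnn.
- by move: hp hk; rewrite pk => ->; rewrite ltnn.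
Qed.

(** * Angles modulo full turns *)

Section Turns.
Variable R : realType.
Implicit Types x y : R.

Lemma cos_turn x (z : int) : cos (2 * pi * (x + z%:~R)) = cos (2 * pi * x).
Proof.
have natE (k : nat) y : cos (2 * pi * (y + k%:R)) = cos (2 * pi * y).
  rewrite -[RHS](periodicn (@cosD2pi R) k).
  by congr cos; rewrite -(mulr_natr (pi *+ 2)) -(mulr_natr pi); ring.
case: z => k; first exact: natE.
by rewrite NegzE rmorphN /= -(natE k.+1 (x - _)) -pmulrn subrK.
Qed.

Lemma sin_turn x (z : int) : sin (2 * pi * (x + z%:~R)) = sin (2 * pi * x).
Proof.
have natE (k : nat) y : sin (2 * pi * (y + k%:R)) = sin (2 * pi * y).
  rewrite -[RHS](periodicn (@sinD2pi R) k).
  by congr sin; rewrite -(mulr_natr (pi *+ 2)) -(mulr_natr pi); ring.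
case: z => k; first exact: natE.
by rewrite NegzE rmorphN /= -(natE k.+1 (x - _)) -pmulrn subrK.
Qed.

(** For the fractional part [d] of [x - y], the cosine of [2 * pi * d] is 1, so the sine of [pi * d]
    vanishes; as [pi * d] lies in [0, pi), [d] is 0. *)
Lemma turn_eq x y : cos (2 * pi * x) = cos (2 * pi * y) ->
  sin (2 * pi * x) = sin (2 * pi * y) -> exists z : int, x = y + z%:~R.
Proof.
move=> cE sE; pose z := Num.floor (x - y); pose d := x - y - z%:~R.
have d0 : 0 <= d by rewrite subr_ge0 floor_le.
have d1 : d < 1 by have := floorD1_gt (x - y); rewrite -/z intrD /d; lra.
have cd : cos (2 * pi * d) = 1.
  have -> : d = (x - y) + (- z)%:~R by rewrite rmorphN.
  by rewrite cos_turn mulrBr cosB cE sE -!expr2 cos2Dsin2.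
have sd : sin (pi * d) = 0.
  have : cos (pi * d + pi * d) = 1 by rewrite -cd; congr cos; ring.
  rewrite cosD -!expr2 cos2sin2 => h; apply/eqP; rewrite -sqrf_eq0; apply/eqP; lra.
have [d_gt0|] := ltP 0 d.
  have := @sin_gt0_pi R (pi * d); rewrite sd ltxx => h.
  by move: h; rewrite mulr_gt0 ?pi_gt0 //= gtr_pMr ?pi_gt0 // d1 => /(_ isT).
move=> d_le0; have d_eq0 : d = 0 by apply/le_anti/andP.
by exists z; move: d_eq0; rewrite /d; lra.
Qed.
End Turns.

(** * Derivatives of coordinates and their signs *)

Section Fst.
Variables (R : realType) (f : R -> R * R) (t : R).
Hypothesis df : derivable f t 1.

Lemma is_derive_fst : is_derive t (1 : R) (fun s => (f s).1) (derive1 f t).1.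
Proof.
pose q h := h^-1 *: (f (h *: 1 + t) - f t).
have cvq : q @ 0^' --> 'D_1 f t := df.
have cv : (fun h : R => h^-1 *: ((f (h *: 1 + t)).1 - (f t).1)) @ 0^' -->
    (derive1 f t).1.
  rewrite derive1E -[X in X @ _]/(fst \o q).
  by apply: (cvg_comp _ _ cvq); exact: cvg_fst.
by apply: DeriveDef; [apply/cvg_ex; exists (derive1 f t).1|exact/cvg_lim].
Qed.

Lemma is_derive_snd : is_derive t (1 : R) (fun s => (f s).2) (derive1 f t).2.
Proof.
pose q h := h^-1 *: (f (h *: 1 + t) - f t).
have cvq : q @ 0^' --> 'D_1 f t := df.
have cv : (fun h : R => h^-1 *: ((f (h *: 1 + t)).2 - (f t).2)) @ 0^' -->
    (derive1 f t).2.
  rewrite derive1E -[X in X @ _]/(snd \o q).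
  by apply: (cvg_comp _ _ cvq); exact: cvg_snd.
by apply: DeriveDef; [apply/cvg_ex; exists (derive1 f t).2|exact/cvg_lim].
Qed.
End Fst.

Lemma is_derive_ge0_right (R : realType) (f : R -> R) (t d e : R) :
    is_derive t (1 : R) f d -> 0 < e ->
    (forall u, t < u < t + e -> f t <= f u) -> 0 <= d.
Proof.
move=> [df <-] e0 fge; pose q h := h^-1 *: (f (h *: 1 + t) - f t).
have cv : q @ 0^'+ --> 'D_1 f t by exact: cvg_dnbhs_at_right df.
rewrite -(cvg_lim (@norm_hausdorff _ R^o) cv).
apply: limr_ge; first by apply/cvg_ex; exists ('D_1 f t).
near=> h; have h0 : 0 < h by near: h; exact: nbhs_right_gt.
have he : h < e by near: h; exact: nbhs_right_lt.
rewrite mulr_ge0 ?invr_ge0 ?(ltW h0) // subr_ge0 [h *: 1]mulr1 fge //.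
by rewrite ltrDr h0 addrC ltrD2l.
Unshelve. all: by end_near.
Qed.

(** * Linking numbers as sums over the letters of a braid word *)

Section StrandAt.
Variable n : nat.
Implicit Types (w : braid_word n) (p k : 'I_n).

(** Inverse of [position w]; the default [p] is never taken, [position w] being bijective. *)
Definition strand_at w p : 'I_n := odflt p [pick k | position w k == p].

Lemma strand_atK w : cancel (strand_at w) (position w).
Proof.
move=> p; rewrite /strand_at; case: pickP => [k /eqP //|no].
by have [v _ vK] := position_bij w; move/eqP: (no (v p)); rewrite vK.
Qed.

Lemma positionK w : cancel (position w) (strand_at w).
Proof. by move=> k; apply: (bij_inj (position_bij w)); rewrite strand_atK. Qed.

Definition over_pos (l : crossing * 'I_n.-1) : 'I_n :=
  if l.1 is Negative then hi l.2 else lo l.2.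

Definition under_pos (l : crossing * 'I_n.-1) : 'I_n :=
  if l.1 is Negative then lo l.2 else hi l.2.

Lemma over_signE l p q : over_sign l p q =
  if (p == over_pos l) && (q == under_pos l) then crossing_sign l.1 else 0.
Proof. by case: l => -[] i; rewrite /over_sign //=; case: ifP. Qed.

Lemma over_count_sum l0 w k k' : over_count w k k' =
  \sum_(q < size w) over_sign (nth l0 w q) (position (take q w) k)
    (position (take q w) k').
Proof.
elim: w k k' => [|l w IH] k k'; first by rewrite big_ord0.
by rewrite big_ord_recl /= IH.
Qed.

Definition over_strand w l0 q := strand_at (take q w) (over_pos (nth l0 w q)).
Definition under_strand w l0 q := strand_at (take q w) (under_pos (nth l0 w q)).

(** After exchanging the sums, each letter counts for exactly one pair of strands, those in its over
    and under positions; [l0] is the default of [nth]. *)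
Lemma braid_linking_sum (K : finType) (c : 'I_n -> K) l0 w i j :
  braid_linking w c i j = \sum_(q < size w)
    if (c (over_strand w l0 q) == i) && (c (under_strand w l0 q) == j)
    then crossing_sign (nth l0 w q).1 else 0.
Proof.
rewrite /braid_linking /comp_over.
under eq_bigr => k _ do
  (under eq_bigr => l _ do rewrite (over_count_sum l0); rewrite exchange_big).
rewrite exchange_big; apply: eq_bigr => q _.
have posE k p : (position (take q w) k == p) = (k == strand_at (take q w) p).
  exact: can2_eq (positionK _) (strand_atK _) _ _.
under eq_bigr => k _ do under eq_bigr => l _ do rewrite over_signE !posE.
rewrite -/(over_strand w l0 q) -/(under_strand w l0 q).
set o := over_strand _ _ _; set v := under_strand _ _ _; set s := crossing_sign _.
rewrite (eq_bigr (fun k => if k == o then if c v == j then s else 0 else 0)).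
  rewrite -big_mkcondr; have [co|co] := eqVneq (c o) i.
    by rewrite (big_pred1 o) // => k /=; case: (eqVneq k o) => [->|_];
      rewrite ?co ?eqxx ?andbF.
  by rewrite big_pred0 // => k; case: (eqVneq k o) => [->|]; rewrite ?(negPf co) ?andbF.
move=> k _; case: eqP => /= _; last by rewrite big1.
rewrite -big_mkcondr; case: eqP => cv.
  by rewrite (big_pred1 v) // => l /=; case: (eqVneq l v) => [->|_];
    rewrite ?cv ?eqxx ?andbF.
by rewrite big_pred0 // => l; case: (eqVneq l v) => [->|_]; rewrite ?andbF //;
  case: eqP.
Qed.
End StrandAt.

(** * Geometry of the closure of a braid word *)

Section ClosureDiagram.
Variables (R : realType) (n : nat) (w : braid_word n) (D : diagram R).
Variables (turns : 'I_(ncomp D) -> nat) (rad : 'I_(ncomp D) -> R -> R).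
Variables (c : 'I_n -> 'I_(ncomp D)) (m : 'I_n -> nat) (theta : seq R).
Let angle i (t : R) : R := 2 * pi * (turns i)%:R * t.
Let param k (u : R) : R := ((m k)%:R + u) / (turns (c k))%:R.
Let dist k u := rad (c k) (param k u).
Let crossed (u : R) := take (count (fun x => x < u) theta) w.

Hypothesis polar : forall i t, [/\ (0 < turns i)%N, 0 < rad i t &
  curve D i t = (rad i t * cos (angle i t), rad i t * sin (angle i t))].
Hypothesis m_lt : forall k, (m k < turns (c k))%N.
Hypothesis strand_ex :
  forall i j, (j < turns i)%N -> exists! k, c k = i /\ m k = j.
Hypothesis theta_size : size theta = size w.
Hypothesis theta_sorted : sorted <%R theta.
Hypothesis theta_in : forall x, x \in theta -> 0 < x < 1.
Hypothesis ordered : forall u k l, 0 <= u <= 1 -> u \notin theta ->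
  (dist k u < dist l u <->
   (position (crossed u) k < position (crossed u) l)%N).
Hypothesis crossingP : forall w1 x i w2, w = w1 ++ (x, i) :: w2 ->
  let u := nth 0 theta (size w1) in
  (forall k l, k != l -> (dist k u = dist l u <->
     (position w1 k = lo i /\ position w1 l = hi i) \/
     (position w1 k = hi i /\ position w1 l = lo i))) /\
  (forall k, position w1 k = lo i -> mark D (curve D (c k) (param k u)) = x).

Let turns_gt0 i : 0 < (turns i)%:R :> R.
Proof. by rewrite ltr0n; have [] := polar i 0. Qed.

Let angleE i t : angle i t = 2 * pi * ((turns i)%:R * t).
Proof. by rewrite /angle mulrA. Qed.

(** Writes [rad] in terms of the smooth curve, whence its periodicity and its derivative. *)
Lemma rad_polar i t :
  rad i t = (curve D i t).1 * cos (angle i t) + (curve D i t).2 * sin (angle i t).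
Proof.
have [_ _ ->] := polar i t; rewrite /= -!mulrA -mulrDr -!expr2 cos2Dsin2.
by rewrite mulr1.
Qed.

Lemma rad_periodic i t (z : int) : rad i (t + z%:~R) = rad i t.
Proof.
rewrite !rad_polar curve_periodicz !angleE [_ * (t + _)]mulrDr.
have -> : (turns i)%:R * z%:~R = ((turns i)%:Z * z)%:~R :> R by rewrite intrM.
by rewrite cos_turn sin_turn.
Qed.

Lemma polar_inj i s j t : curve D i s = curve D j t -> rad i s = rad j t /\
  exists z : int, (turns i)%:R * s = (turns j)%:R * t + z%:~R.
Proof.
have [_ ri ->] := polar i s; have [_ rj ->] := polar j t => -[e1 e2].
have r2 : rad i s ^+ 2 = rad j t ^+ 2.
  rewrite -[LHS]mulr1 -[RHS]mulr1 -{1}(cos2Dsin2 (angle i s)).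
  by rewrite -(cos2Dsin2 (angle j t)) !mulrDr -!exprMn e1 e2.
have r : rad i s = rad j t by apply/eqP; rewrite -(@eqrXn2 _ 2%N) ?(ltW ri) ?(ltW rj) ?r2.
split=> //; rewrite r in e1 e2; have rj0 : rad j t != 0 by rewrite gt_eqF.
by apply: turn_eq; rewrite -!angleE; [apply: (mulfI rj0 e1)|apply: (mulfI rj0 e2)].
Qed.

(** The velocity in the polar frame: its radial component is the derivative of [rad], its tangential
    one the angular speed times the radius. *)
Lemma rad_derive i t (v := velocity (curve D) (i, t)) :
  is_derive t (1 : R) (rad i) (v.1 * cos (angle i t) + v.2 * sin (angle i t)) /\
  v.2 * cos (angle i t) - v.1 * sin (angle i t) =
    2 * pi * (turns i)%:R * rad i t.
Proof.
have dv : derivable (curve D i) t 1 := @curve_smooth R D i 0%N t.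
have d1 := is_derive_fst dv; have d2 := is_derive_snd dv.
rewrite -/v.1 -/v.2 in d1 d2.
pose a := 2 * pi * (turns i)%:R : R.
have da : is_derive t (1 : R) (angle i) a.
  have -> : angle i = a \*: id by apply/funext.
  by apply: is_derive_eq; rewrite [_ *: _]mulr1.
have dc : is_derive t (1 : R) (cos \o angle i) (- sin (angle i t) * a).
  exact: is_derive1_comp.
have ds : is_derive t (1 : R) (sin \o angle i) (cos (angle i t) * a).
  exact: is_derive1_comp.
have [_ r0 curveE] := polar i t.
have X : (curve D i t).1 = rad i t * cos (angle i t) by rewrite curveE.
have Y : (curve D i t).2 = rad i t * sin (angle i t) by rewrite curveE.
have cs := cos2Dsin2 (angle i t).
split.
  have -> : rad i = (fun s => (curve D i s).1) * (cos \o angle i) +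
      (fun s => (curve D i s).2) * (sin \o angle i).
    by apply/funext => s; rewrite rad_polar.
  have d12 := is_deriveD (is_deriveM d1 dc) (is_deriveM d2 ds).
  apply: (is_derive_eq d12); rewrite /= X Y /GRing.scale /=.
  by move: (rad i t) (cos _) (sin _) v.1 v.2 => *; ring.
(* The tangential coordinate of the position is identically zero; differentiating it gives the
   second identity. *)
have d0 : is_derive t (1 : R) ((fun s => (curve D i s).2) * (cos \o angle i) -
    (fun s => (curve D i s).1) * (sin \o angle i)) 0.
  rewrite (_ : _ - _ = cst 0); first exact: is_derive_cst.
  apply/funext => s; have [_ _ E] := polar i s.
  by rewrite /GRing.mul /= /GRing.add /GRing.opp /= E /=; ring.
have d0' := is_deriveB (is_deriveM d2 dc) (is_deriveM d1 ds).
have := @derive_val _ _ _ _ _ _ _ d0; rewrite (@derive_val _ _ _ _ _ _ _ d0').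
rewrite /= X Y /GRing.scale /= -/a => E.
have -> : a * rad i t =
    a * rad i t * (cos (angle i t) ^+ 2 + sin (angle i t) ^+ 2) by rewrite cs mulr1.
apply/eqP; rewrite -subr_eq0 -E; apply/eqP; ring.
Qed.

Lemma dist_derive k u (v := velocity (curve D) (c k, param k u)) :
  is_derive u (1 : R) (dist k) ((v.1 * cos (angle (c k) (param k u)) +
    v.2 * sin (angle (c k) (param k u))) / (turns (c k))%:R).
Proof.
have [dr _] := rad_derive (c k) (param k u).
have dp : is_derive u (1 : R) (param k) (turns (c k))%:R^-1.
  have -> : param k = (turns (c k))%:R^-1 \*: (cst (m k)%:R + id).
    by apply/funext => x; rewrite /param mulrC.
  by apply: is_derive_eq; rewrite add0r [_ *: _]mulr1.
exact: is_derive1_comp.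
Qed.

Lemma angle_param k u : (turns (c k))%:R * param k u = (m k)%:R + u.
Proof. by rewrite /param mulrC divfK ?gt_eqF. Qed.

Lemma cos_param k u : cos (angle (c k) (param k u)) = cos (2 * pi * u).
Proof. by rewrite angleE angle_param addrC (cos_turn u (m k)). Qed.

Lemma sin_param k u : sin (angle (c k) (param k u)) = sin (2 * pi * u).
Proof. by rewrite angleE angle_param addrC (sin_turn u (m k)). Qed.

Lemma curve_param k u : curve D (c k) (param k u) =
  (dist k u * cos (2 * pi * u), dist k u * sin (2 * pi * u)).
Proof. by have [_ _ ->] := polar (c k) (param k u); rewrite cos_param sin_param. Qed.

Definition crossing_vel k u := velocity (curve D) (c k, param k u).

(* If the strand l is locally on the inner side of k after a common point, then
   k turns outwards from l there. *)
Lemma crossing_direction k l u e : dist k u = dist l u -> 0 < e ->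
    (forall v, u < v < u + e -> dist l v <= dist k v) ->
  0 <= det2 (crossing_vel k u) (crossing_vel l u).
Proof.
move=> kl e0 le; have dk := dist_derive k u; have dl := dist_derive l u.
have dkl := is_deriveB dk dl.
have := is_derive_ge0_right dkl e0.
rewrite -/(crossing_vel k u) -/(crossing_vel l u) !cos_param !sin_param.
have [_ fk] := rad_derive (c k) (param k u).
have [_ fl] := rad_derive (c l) (param l u).
rewrite -/(crossing_vel k u) !cos_param !sin_param -/(dist k u) in fk.
rewrite -/(crossing_vel l u) !cos_param !sin_param -/(dist l u) -kl in fl.
have r0 : 0 < dist k u by have [] := polar (c k) (param k u).
have Tk := turns_gt0 (c k); have Tl := turns_gt0 (c l).
have cs := cos2Dsin2 (2 * pi * u : R).
have p0 : 0 < 2 * pi :> R by rewrite mulr_gt0 ?pi_gt0.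
move: fk fl cs p0 r0 Tk Tl; rewrite /det2.
move: (crossing_vel k u) (crossing_vel l u) => -[v1 v2] [w1 w2] /=.
move: (cos _) (sin _) => C S.
move: (2 * pi) (turns (c k))%:R (turns (c l))%:R => P T T' fk fl cs P0 r0 T0 T0'.
have le' v : u < v < u + e -> (dist k - dist l) u <= (dist k - dist l) v.
  move=> uv; rewrite -[X in X <= _]/(dist k u - dist l u) kl subrr.
  by rewrite -[X in _ <= X]/(dist k v - dist l v) subr_ge0; exact: le.
move=> /(_ le') h; move: fk fl r0; move: (dist k u) => r fk fl r0.
(* The tangential components are [P * T * r] and [P * T' * r], so the determinant is a positive
   multiple of the difference of the derivatives of [dist k] and [dist l]. *)
have -> : v1 * w2 - v2 * w1 =
    ((v1 * C + v2 * S) / T - (w1 * C + w2 * S) / T') * (P * T * T' * r).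
  have -> : v1 * w2 - v2 * w1 = (v1 * w2 - v2 * w1) * (C ^+ 2 + S ^+ 2).
    by rewrite cs mulr1.
  have -> : (v1 * w2 - v2 * w1) * (C ^+ 2 + S ^+ 2) =
      (v1 * C + v2 * S) * (w2 * C - w1 * S) -
      (w1 * C + w2 * S) * (v2 * C - v1 * S) by ring.
  by rewrite fk fl; field; rewrite !gt_eqF.
by rewrite mulr_ge0 // !mulr_ge0 // ltW.
Qed.

Lemma crossed0 : crossed 0 = [::].
Proof.
rewrite /crossed (@eq_in_count _ _ pred0) ?count_pred0 ?take0 // => x xt.
by have /andP[x0 _] := theta_in xt; rewrite /= ltNge ltW.
Qed.

Lemma crossed1 : crossed 1 = w.
Proof.
rewrite /crossed (@eq_in_count _ _ predT) ?count_predT ?theta_size ?take_size //.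
by move=> x xt; have /andP[_ ->] := theta_in xt.
Qed.

Lemma notin_theta0 : 0 \notin theta.
Proof. by apply/negP => /theta_in; rewrite ltxx. Qed.

Lemma notin_theta1 : 1 \notin theta.
Proof. by apply/negP => /theta_in; rewrite ltxx andbF. Qed.

(** The strand that continues [k] starts at the distance where [k] ends. Distances are ordered by
    initial positions at time 0 and by final positions at time 1, so [ord_increasing_eq] identifies
    it with [position w k]. *)
Lemma closure_closes_up : closes_up w c m turns.
Proof.
have next k : exists k', c k' = c k /\
    m k' = if (m k).+1 == turns (c k) then 0%N else (m k).+1.
  have lt : ((if (m k).+1 == turns (c k) then 0%N else (m k).+1) < turns (c k))%N.
    have [_|ne] := eqVneq; last by rewrite ltn_neqAle ne m_lt.
    exact: leq_ltn_trans (leq0n _) (m_lt k).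
  by have [k' [? _]] := strand_ex lt; exists k'.
have [nxt nxtP] := choice next.
have distE k : dist (nxt k) 0 = dist k 1.
  have [ck mk] := nxtP k; rewrite /dist /param ck mk addr0.
  case: eqP => [kT|_]; last by rewrite natr1.
  by rewrite mul0r natr1 kT divff ?gt_eqF // -(rad_periodic _ 0 1) add0r.
have nxtE : nxt =1 position w.
  apply: ord_increasing_eq (position_bij w) _ => k l.
  have i0 : 0 <= (0 : R) <= 1 by rewrite le_refl ler01.
  have i1 : 0 <= (1 : R) <= 1 by rewrite ler01 le_refl.
  have := @ordered 0 (nxt k) (nxt l) i0 notin_theta0.
  rewrite crossed0 !distE => h0.
  have := @ordered 1 k l i1 notin_theta1; rewrite crossed1 => h1.
  by apply/idP/idP => [/h0 /h1|/h1 /h0].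
split=> //.
- by move=> i; have [] := polar i 0.
- by move=> k; rewrite -nxtE; have [] := nxtP k.
- by move=> k; rewrite -nxtE; have [] := nxtP k.
Qed.

(** As [theta] is finite, no crossing time follows immediately; being sorted, it has exactly [q.+1]
    entries up to that of index [q]. *)
Lemma after_crossing q : (q < size w)%N -> exists2 e, 0 < e & forall v,
  nth 0 theta q < v < nth 0 theta q + e ->
  [/\ 0 <= v <= 1, v \notin theta & crossed v = take q.+1 w].
Proof.
move=> qw; have qt : (q < size theta)%N by rewrite theta_size.
set u := nth 0 theta q; have ut : u \in theta := mem_nth 0 qt.
have /andP[u0 u1] := theta_in ut.
have [e e0 eP] : exists2 e, 0 < e & forall v, u < v < u + e ->
    forall x, x \in theta -> (x < v) = (x <= u) /\ x != v.
  elim: {u0 u1 ut qt}theta => [|x s [e e0 IH]]; first by exists 1.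
  have [xu|ux] := leP x u.
    exists e => // v uv y; rewrite inE => /orP[/eqP ->|]; last exact: IH.
    have /andP[uv' _] := uv; rewrite xu (le_lt_trans xu uv').
    by split=> //; rewrite lt_eqF // (le_lt_trans xu uv').
  exists (Num.min e (x - u)); first by rewrite lt_min e0 subr_gt0.
  move=> v /andP[uv]; rewrite -ltrBlDl lt_min => /andP[ve vx] y.
  have vx' : v < x by move: vx; lra.
  rewrite inE => /orP[/eqP ->|ys].
    by rewrite (lt_gtF vx') (lt_geF ux) gt_eqF.
  by apply: IH ys; rewrite uv -ltrBlDl.
exists (Num.min e (1 - u)); first by rewrite lt_min e0 subr_gt0.
move=> v /andP[uv]; rewrite -ltrBlDl lt_min => /andP[ve v1].
have {}eP := eP v; rewrite uv -ltrBlDl ve in eP; split.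
- by rewrite (ltW (lt_trans u0 uv)) /=; move: v1; lra.
- by apply/negP => vt; have [_] := eP isT _ vt; rewrite eqxx.
- rewrite /crossed (@eq_in_count _ _ (<= u)%O).
    by rewrite count_le_nth.
  by move=> x xt; have [-> _] := eP isT x xt.
Qed.

(** The residue of [N] modulo the number of turns is the index of the turn, and the quotient is the
    integer separating the parameters. *)
Lemma strand_through i s u (N : int) : (turns i)%:R * s = N%:~R + u ->
  exists k, same_point (c k, param k u) (i, s).
Proof.
move=> e; pose T := (turns i)%:Z; have [Tn _ _] := polar i 0.
have T0 : T != 0 by rewrite /T; lia.
have [k [[ck mk] _]] : exists! k, c k = i /\ m k = `|(N %% T)%Z|%N.
  apply: strand_ex; rewrite -ltz_nat gez0_abs ?modz_ge0 //.
  by apply: ltz_pmod; rewrite /T; lia.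
exists k; split=> //=; exists (N %/ T)%Z.
have mkE : (m k)%:R = (N %% T)%Z%:~R :> R by rewrite mk pmulrn gez0_abs ?modz_ge0.
have tR : (turns i)%:R != 0 :> R by rewrite gt_eqF.
rewrite /param ck mkE; apply: (mulfI tR); rewrite e mulrDr mulrC divfK //.
have -> : N%:~R = (N %/ T)%Z%:~R * (turns i)%:R + (N %% T)%Z%:~R :> R.
  by rewrite {1}(divz_eq N T) rmorphD rmorphM.
by ring.
Qed.

(** Meeting points have the same angle, so their numbers of turns have a common fractional part
    [u]. *)
Lemma crossing_time i j s t : meet (curve D) (i, s) (j, t) -> i != j ->
  exists k l u, [/\ same_point (c k, param k u) (i, s),
    same_point (c l, param l u) (j, t), k != l, dist k u = dist l u & u \in theta].
Proof.
move=> [_ /polar_inj [r [z e]]] ij.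
pose N := Num.floor ((turns i)%:R * s); pose u := (turns i)%:R * s - N%:~R.
have [k ks] : exists k, same_point (c k, param k u) (i, s).
  by apply: (@strand_through i s u N); rewrite addrC subrK.
have [l lt] : exists l, same_point (c l, param l u) (j, t).
  by apply: (@strand_through j t u (N - z)); rewrite /u e rmorphB /=; lra.
have kl : k != l.
  apply: contraNneq ij => kl; have [/= <- _] := ks; have [/= <- _] := lt.
  by rewrite kl.
have radE k' i' s' : same_point (c k', param k' u) (i', s') ->
    dist k' u = rad i' s'.
  by move=> [/= <- [z' ->]]; rewrite rad_periodic.
have d : dist k u = dist l u by rewrite (radE _ _ _ ks) (radE _ _ _ lt) r.
exists k, l, u; split=> //; apply: contraT => ut.
have u01 : 0 <= u <= 1.
  have := floor_le ((turns i)%:R * s); have := floorD1_gt ((turns i)%:R * s).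
  by rewrite -/N intrD /u => ? ?; apply/andP; split; lra.
(* Outside [theta] the order by distance is the order of positions, so equal distances would force
   [k = l]. *)
have := (@ordered u k l u01 ut).2; have := (@ordered u l k u01 ut).2.
rewrite d ltxx => h1 h2; case/eqP: kl; apply: (bij_inj (position_bij (crossed u))).
by apply/val_inj/eqP; case: ltngtP => // [/h2|/h1].
Qed.

(** * Letters of the word and crossings of the closure *)

Section Letters.
Variable l0 : crossing * 'I_n.-1.

Let time q := nth 0 theta q.
Let letter q := nth l0 w q.
Let lower q := strand_at (take q w) (lo (letter q).2).
Let upper q := strand_at (take q w) (hi (letter q).2).

Let w_split q : (q < size w)%N ->
  w = take q w ++ ((letter q).1, (letter q).2) :: drop q.+1 w.
Proof.
by move=> qw; rewrite -surjective_pairing -(drop_nth l0) // cat_take_drop.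
Qed.

Lemma time_in q : (q < size w)%N -> time q \in theta.
Proof. by move=> qw; rewrite mem_nth ?theta_size. Qed.

Lemma time_inj p q (z : int) : (p < size w)%N -> (q < size w)%N ->
  time p = time q + z%:~R -> p = q.
Proof.
move=> pw qw e; have /andP[p0 p1] := theta_in (time_in pw).
have /andP[q0 q1] := theta_in (time_in qw).
have z0 : z = 0.
  have : (-1)%:~R < z%:~R :> R by rewrite mulrN1z; lra.
  have : z%:~R < 1%:~R :> R by rewrite mulr1z; lra.
  by rewrite !ltr_int; lia.
move: e; rewrite z0 addr0 => /eqP; rewrite nth_uniq ?theta_size //.
  by move/eqP.
exact: lt_sorted_uniq theta_sorted.
Qed.

Lemma crossing_dist q : (q < size w)%N -> forall k l, k != l ->
  dist k (time q) = dist l (time q) <->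
    (k = lower q /\ l = upper q) \/ (k = upper q /\ l = lower q).
Proof.
move=> qw k l kl; have [h _] := crossingP (w_split qw).
move: h; rewrite size_takel ?(ltnW qw) // => /(_ k l kl) ->.
have E p p' : position (take q w) p = p' <-> p = strand_at (take q w) p'.
  by split=> [<-|->]; rewrite ?positionK ?strand_atK.
by rewrite !E.
Qed.

Lemma lower_upper q : (q < size w)%N ->
  lower q != upper q /\ dist (lower q) (time q) = dist (upper q) (time q).
Proof.
move=> qw; have lu : lower q != upper q.
  apply/eqP => /(congr1 (position (take q w))); rewrite !strand_atK => /eqP.
  by rewrite eq_sym hi_lo.
by split=> //; apply/(crossing_dist qw lu); left.
Qed.

Lemma crossing_mark q : (q < size w)%N ->
  mark D (curve D (c (lower q)) (param (lower q) (time q))) = (letter q).1.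
Proof.
move=> qw; have [_ h] := crossingP (w_split qw); move: h.
by rewrite size_takel ?(ltnW qw) // => -> //; rewrite strand_atK.
Qed.

(** Just after the crossing the strand [lower q] is in the outer of the two positions, so
    [crossing_direction] applies. *)
Lemma crossing_sense q : (q < size w)%N ->
  0 <= det2 (crossing_vel (lower q) (time q)) (crossing_vel (upper q) (time q)).
Proof.
move=> qw; have [lu eq] := lower_upper qw.
have [e e0 eP] := after_crossing qw.
apply: (crossing_direction eq e0) => v /eP [v01 vt vE]; apply/ltW.
apply/(@ordered _ _ _ v01 vt); rewrite vE (take_nth l0) // !position_rcons.
by rewrite !strand_atK step_lo step_hi /=.
Qed.

Lemma meet_crossing q : (q < size w)%N -> c (lower q) != c (upper q) ->
  meet (curve D) (c (lower q), param (lower q) (time q))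
    (c (upper q), param (upper q) (time q)).
Proof.
move=> qw ne; have [_ eq] := lower_upper qw; split.
  by move=> [/= /eqP]; rewrite (negPf ne).
by rewrite /at_point /= !curve_param eq.
Qed.

Lemma crossing_sense_gt0 q : (q < size w)%N -> c (lower q) != c (upper q) ->
  0 < det2 (crossing_vel (lower q) (time q)) (crossing_vel (upper q) (time q)).
Proof.
move=> qw ne; rewrite lt_def crossing_sense // andbT.
exact: curve_transverse (meet_crossing qw ne).
Qed.

Let over_at k l q := over (c k, param k (time q)) (c l, param l (time q)).

Lemma over_lower q : (q < size w)%N -> c (lower q) != c (upper q) ->
  over_at (lower q) (upper q) q <-> (letter q).1 = Positive.
Proof.
move=> qw ne; have d0 := crossing_sense_gt0 qw ne.
rewrite /over_at overE crossing_mark //; split=> [[_]|->].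
  by case: (letter q).1 => //=; rewrite -/(crossing_vel _ _) lt_gtF.
split; [exact: meet_crossing|exact: d0].
Qed.

Lemma over_upper q : (q < size w)%N -> c (lower q) != c (upper q) ->
  over_at (upper q) (lower q) q <-> (letter q).1 = Negative.
Proof.
move=> qw ne; have d0 := crossing_sense_gt0 qw ne.
have mk := crossing_mark qw; have mt := meet_crossing qw ne.
rewrite /over_at overE -(proj2 mt) [at_point _ _]/= mk.
rewrite det2C -/(crossing_vel _ _) -/(crossing_vel _ _).
split=> [[_]|->].
  by case: (letter q).1 => //=; rewrite oppr_gt0 lt_gtF.
split; [exact: meet_sym|by rewrite /= oppr_lt0].
Qed.

(** The points where [i] passes over [j] correspond to the classical letters with over strand in [i]
    and under strand in [j]. *)
Lemma closure_linking_letter i j : i != j ->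
  linking_number D i j = braid_linking w c i j.
Proof.
move=> ij; rewrite (braid_linking_sum c l0).
pose o q := over_strand w l0 q; pose v q := under_strand w l0 q.
pose P := [pred q : 'I_(size w) | (c (o q) == i) && (c (v q) == j)].
pose Q := [set q : 'I_(size w) |
  [/\ c (o q) = i, c (v q) = j & (letter q).1 <> Virtual]].
pose h (q : 'I_(size w)) := curve D (c (o q)) (param (o q) (time q)).
have ovE q : (o q = lower q /\ v q = upper q /\ (letter q).1 <> Negative) \/
    (o q = upper q /\ v q = lower q /\ (letter q).1 = Negative).
  rewrite /o /v /over_strand /under_strand /over_pos /under_pos -/(letter q).
  by case E : (letter q).1; [left|right|left]; rewrite /lower /upper.
have Qover (q : 'I_(size w)) : Q q -> over_at (o q) (v q) q.
  move=> [oi vj nv]; have [[oE [vE nN]]|[oE [vE N]]] := ovE q.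
    rewrite oE vE; apply/over_lower => //; first by rewrite -oE -vE oi vj.
    by move: nv nN; case: (letter q).1.
  rewrite oE vE; apply/over_upper => //.
  by rewrite -oE -vE oi vj eq_sym.
have hmark (q : 'I_(size w)) : Q q -> mark D (h q) = (letter q).1.
  move=> Qq; rewrite -(crossing_mark (ltn_ord q)); congr (mark D _).
  have [_ eq] := lower_upper (ltn_ord q).
  by have [[oE _]|[oE _]] := ovE q; rewrite /h oE ?curve_param ?eq.
rewrite /linking_number (reindex_fsbig h Q); last first.
  split.
  - move=> q Qq; have [oi vj _] := Qq; rewrite -oi -vj.
    by exists (param (o q) (time q)), (param (v q) (time q)); split; [exact: Qover|].
  - move=> p q _ _ /polar_inj [_ [z]]; rewrite !angle_param => e.
    apply/val_inj.
    (* Equal points have numbers of turns differing by the integer [z]; removing the whole turns [m]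
       leaves times that differ by an integer. *)
    apply: (@time_inj p q (z + (m (o q))%:Z - (m (o p))%:Z)) => //.
    by rewrite rmorphB rmorphD /=; lra.
  - move=> x [s [t [st xE]]].
    have [k [l [u [ks lt kl d ut]]]] := crossing_time (over_meet st) ij.
    have st' := over_same (same_point_sym ks) (same_point_sym lt) st.
    have ltq : (index u theta < size w)%N by rewrite -theta_size index_mem.
    pose q := Ordinal ltq; have uE : u = time q by rewrite /time nth_index.
    have [ki lj] : c k = i /\ c l = j by case: ks; case: lt.
    have kE : k = o q /\ l = v q /\ (letter q).1 <> Virtual.
      have clu : c k != c l by rewrite ki lj.
      rewrite uE in st' d.
      have [[kL lU]|[kU lL]] := (crossing_dist (ltn_ord q) kl).1 d.
        rewrite kL lU in st' clu *.
        have pos := (over_lower (ltn_ord q) clu).1 st'.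
        have [[-> [-> _]]|[_ [_ neg]]] := ovE q; first by rewrite pos.
        by move: neg; rewrite pos.
      rewrite kU lL in st' clu *; rewrite eq_sym in clu.
      have neg := (over_upper (ltn_ord q) clu).1 st'.
      have [[_ [_ nN]]|[-> [-> _]]] := ovE q; last by rewrite neg.
      by case: nN; rewrite neg.
    have [kE1 [lE1 nv]] := kE.
    exists q; first by split; [rewrite -kE1|rewrite -lE1|].
    rewrite /h -kE1 -uE xE; exact: esym (at_point_same ks).
rewrite (_ : \sum_(q \in Q) _ = \sum_(q \in Q) crossing_sign (letter q).1);
  last by apply: eq_fsbigr => q; rewrite inE => Qq; rewrite hmark.
(* Virtual letters, whose sign is 0, are put back. *)
rewrite (fsbig_widen _ [set` P]); last 2 first.
- by move=> q [oi vj _]; rewrite /= inE oi vj !eqxx.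
- move=> q [/= /andP[/eqP oi /eqP vj] nQ].
  by case E : (letter q).1 => //; case: nQ; split=> //; rewrite E.
rewrite -(bigfs _ (index_enum_uniq _)); last first.
  by move=> q _; rewrite mem_index_enum.
by rewrite big_mkcond.
Qed.
End Letters.

Lemma closure_linking i j : i != j ->
  linking_number D i j = braid_linking w c i j.
Proof.
(* An empty word offers no default letter [l0]; its closure has no crossing between distinct
   components. *)
move=> ij; have [w0|[l0 _]] : w = [::] \/ exists l0 : crossing * 'I_n.-1, True.
- by case: (w) => [|l0 w']; [left|right; exists l0].
- rewrite /linking_number fsbig1.
    rewrite /braid_linking big1 // => k _; rewrite /comp_over big1 // => l _.
    by rewrite w0.
  move=> x [s [t [/over_meet st _]]].
  have [k [l [u [_ _ _ _ ut]]]] := crossing_time st ij.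
  by move: theta_size ut; rewrite w0 => /size0nil ->.
exact (closure_linking_letter l0 ij).
Qed.
End ClosureDiagram.

Lemma closure_fused_link_group (R : realType) n (b : UVB n) (D : diagram R)
    (u : 'I_n -> free_group 'I_n) :
  closure_of b D -> represents b u ->
  exists2 a : 'I_(ncomp D) -> 'I_(ncomp D) -> int,
    (forall i j, i != j -> linking_number D i j = a i j) &
    isomorphic (linking_group a) (fused_link_group u).
Proof.
move=> [w [wb [turns [rad [c [m [theta [polar [m_lt ex] [ts tS tin] ord cr]]]]]]]].
rewrite -wb => wu; exists (braid_linking w c).
  by move=> i j ij; exact (closure_linking polar ex ts tS tin ord cr ij).
apply: closure_linking_group wu.
exact (closure_closes_up polar m_lt ex ts tin ord).
Qed.

Theorem proposition4p10 (R : realType) (n m : nat) (b : UVB n) (b' : UVB m)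
    (D D' : diagram R)
    (u : 'I_n -> free_group 'I_n) (u' : 'I_m -> free_group 'I_m) :
  closure_of b D -> closure_of b' D' -> fused_isotopic D D' ->
  represents b u -> represents b' u' ->
  isomorphic (fused_link_group u) (fused_link_group u').
Proof.
move=> bD bD' /fused_isotopic_linked [e [eb ee]] bu bu'.
have [a aE aI] := closure_fused_link_group bD bu.
have [a' aE' aI'] := closure_fused_link_group bD' bu'.
apply: isomorphic_trans (isomorphic_sym aI) (isomorphic_trans _ aI').
apply: (linking_group_relabel eb) => i j ij.
by rewrite -aE' ?(bij_eq eb) // ee // aE.
Qed.
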